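(* Let $0<\alpha<1$ and $\theta\ge 0$, let $(T_n^{\alpha,\theta},n\ge 1)$ be an $(\alpha,\theta)$-tree growth process, and let $T_n^{\alpha,\theta,\circ}$, $n\ge 1$, be the associated delabeled trees. Then: (a) $T_n^{\alpha,\theta}$ has exchangeable leaf labels for all $n\ge 1$ if and only if $\alpha=\theta=1/2$. (b) $(T_n^{\alpha,\theta,\circ},n\ge 1)$ is strongly sampling consistent if and only if $\alpha=\theta=1/2$. (c) $(T_n^{\alpha,\theta,\circ},n\ge 1)$ is weakly sampling consistent if and only if $\theta=1-\alpha$ or $\theta=2-\alpha$.
   Context: Trees. $[n]=\{1,\dots,n\}$. $\mathbb{T}_{[n]}$ is the set of rooted binary trees with $n$ leaves labeled by $[n]$: the root and the leaves have degree 1, all other vertices (branch points) have degree 3; there are $2n-1$ edges. Trees are non-planar (considered up to isomorphism preserving root and leaf labels). The root edge of a tree is the edge adjacent to its root. For $n\ge2$ a tree splits at the branch point adjacent to the root into two subtrees, each of which is rooted at that branch point (so each subtree has its own root edge, starting at that branch point). $(\alpha,\theta)$-tree growth process ($0\le\alpha\le1$, $\theta\ge0$). $T_1$ is a single edge joining the root and leaf 1. $T_2$ is the Y-shaped tree with root, one branch point and leaves 1, 2. For $n\ge2$, given $T_1,\dots,T_n$, an edge $a_n\to c_n$ of $T_n$ (directed away from the root) is selected at random as described below, and $T_{n+1}$ is obtained by replacing it by three edges $a_n\to b_n$, $b_n\to c_n$, $b_n\to n+1$, where $b_n$ is a new branch point and $n+1$ a new leaf. Selection rule: let the two subtrees of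 $T_n$ above the branch point adjacent to the root be $T_{n,0}$ with $m$ leaves and $T_{n,1}$ with $n-m$ leaves, where $T_{n,1}$ contains the smallest leaf label of $T_n$. Assign weight $\alpha$ to the root edge, $m-\alpha$ to $T_{n,0}$ and $n-m-1+\theta$ to $T_{n,1}$. Choose the root edge or one of the subtrees with probability proportional to these weights. If a subtree with at least two leaves was chosen, apply the same procedure recursively to that subtree (with its own root edge, number of leaves and smallest label), until a root edge or a subtree with a single leaf is chosen; in the latter case the unique edge of this subtree is selected. Delabeled tree: $T_n^\circ$ is $T_n$ with leaf labels removed (an unlabeled rooted binary tree). Exchangeable leaf labels: the law of $T_n$ on $\mathbb{T}_{[n]}$ is invariant under all permutations of the labels $[n]$. Sampling consistency: let $\widehat T_n^\circ$ be obtained from $T_{n+1}^\circ$ by removing a leaf chosen uniformly at random (together with its edge, suppressing the resulting degree-2 vertex). The process is weakly sampling consistent if $T_n^\circ$ and $\widehat T_n^\circ$ have the same distribution for all $n\ge1$, and strongly sampling consistent if $(T_n^\circ,T_{n+1}^\circ)$ and $(\widehat T_n^\circ,T_{n+1}^\circ)$ have the same distribution for all $n\ge1$. *)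

(* Defs.v *)
From HB Require Import structures.
From mathcomp Require Import all_boot all_order all_algebra generic_quotient.
From mathcomp Require Import all_classical all_reals all_analysis.

Set Implicit Arguments.
Unset Strict Implicit.
Unset Printing Implicit Defensive.

Import Order.TTheory GRing.Theory Num.Theory.

Local Open Scope classical_set_scope.
Local Open Scope quotient_scope.
Local Open Scope ring_scope.

(* A planar rooted binary tree with leaf labels in A. The root, which has     *)
(* degree 1, and the root edge are implicit: [Leaf a] is the tree with one    *)
(* edge, from the root to leaf a, and [Node l r] is a root edge ending in a   *)
(* branch point at which the planar trees l and r are rooted. The edges of a  *)
(* tree thus correspond to its subterms, each subterm to its own root edge.   *)
Inductive tree (A : Type) : Type :=
| Leaf of A
| Node of tree A & tree A.

Section TreeChoice.
Variable A : choiceType.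

Fixpoint tree_encode (t : tree A) : GenTree.tree A :=
  match t with
  | Leaf a => GenTree.Leaf a
  | Node l r => GenTree.Node 0 [:: tree_encode l; tree_encode r]
  end.

Fixpoint tree_decode (t : GenTree.tree A) : option (tree A) :=
  match t with
  | GenTree.Leaf a => Some (Leaf a)
  | GenTree.Node _ [:: l; r] =>
      if (tree_decode l, tree_decode r) is (Some l', Some r')
      then Some (Node l' r') else None
  | _ => None
  end.

Lemma tree_encodeK : pcancel tree_encode tree_decode.
Proof. by elim=> [a|l IHl r IHr] //=; rewrite IHl IHr. Qed.

HB.instance Definition _ := Choice.copy (tree A) (pcan_type tree_encodeK).

End TreeChoice.

Fixpoint labels (A : Type) (t : tree A) : seq A :=
  match t with
  | Leaf a => [:: a]
  | Node l r => labels l ++ labels r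
  end.

Definition nleaves (A : Type) (t : tree A) : nat := size (labels t).

Fixpoint tmap (A B : Type) (f : A -> B) (t : tree A) : tree B :=
  match t with
  | Leaf a => Leaf (f a)
  | Node l r => Node (tmap f l) (tmap f r)
  end.

Fixpoint minlabel (t : tree nat) : nat :=
  match t with
  | Leaf a => a
  | Node l r => minn (minlabel l) (minlabel r)
  end.

(* Isomorphism of non-planar trees, preserving the root and the leaf labels.  *)
Fixpoint iso (A : eqType) (t u : tree A) : bool :=
  match t, u with
  | Leaf a, Leaf b => a == b
  | Node l r, Node l' r' => (iso l l' && iso r r') || (iso l r' && iso r l')
  | _, _ => false
  end.

Section Iso.
Variable A : eqType.
Implicit Types t u v : tree A.

Lemma iso_refl : reflexive (@iso A).
Proof. by elim=> [a|l IHl r IHr] /=; rewrite ?eqxx // IHl IHr. Qed.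

Lemma iso_sym : symmetric (@iso A).
Proof.
elim=> [a|l IHl r IHr] [b|l' r'] //=.
by rewrite !(IHl, IHr) [iso r' l && _]andbC.
Qed.

Lemma iso_trans : transitive (@iso A).
Proof.
move=> u t v; elim: u t v => [b|l IHl r IHr] [a|l1 r1] [c|l2 r2] //=.
  by move=> /eqP-> /eqP->.
by move=> /orP[]/andP[h1 h2] /orP[]/andP[h3 h4]; apply/orP;
  [left|right|right|left];
  rewrite ?(IHl _ _ h1 h3, IHr _ _ h1 h4, IHr _ _ h2 h4, IHl _ _ h2 h3) //;
  apply/andP; split; first [exact: IHl h1 _ | exact: IHr h1 _
                           | exact: IHl h2 _ | exact: IHr h2 _].
Qed.

Canonical iso_equiv := EquivRel (@iso A) iso_refl iso_sym iso_trans.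

End Iso.

Definition nptree (A : choiceType) : Type := {eq_quot (@iso_equiv A)}.
HB.instance Definition _ (A : choiceType) := Choice.on (nptree A).
HB.instance Definition _ (A : choiceType) := EqQuotient.on (nptree A).

HB.instance Definition _ (A : pointedType) :=
  isPointed.Build (nptree A) (\pi_(nptree A) (Leaf point)).
HB.instance Definition _ (A : pointedType) :=
  @isMeasurable.Build default_measure_display (nptree A) discrete_measurable
    discrete_measurable0 discrete_measurableC discrete_measurableU.

Notation ltree := (nptree nat).
Notation utree := (nptree unit).

Definition npleaf (A : choiceType) (a : A) : nptree A :=
  \pi_(nptree A) (Leaf a).

Definition npY (A : choiceType) (a b : A) : nptree A :=
  \pi_(nptree A) (Node (Leaf a) (Leaf b)).

Definition relabel (A B : choiceType) (f : A -> B) (t : nptree A) : nptree B :=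
  \pi_(nptree B) (tmap f (repr t)).

Definition delabel (t : ltree) : utree := relabel (fun=> tt) t.

(* One entry (c, t') per edge e of t: c is the probability that the selection *)
(* rule with parameters alpha and theta selects e, and t' is t with the new   *)
(* leaf x attached to e. The weight of the subtree s that contains the        *)
(* smallest label is w1 s, that of the other one is w0 s; w is the sum of the *)
(* weights.                                                                   *)
Fixpoint growths (R : realType) (alpha theta : R) (x : nat) (t : tree nat) :
    seq (R * tree nat) :=
  match t with
  | Leaf _ => [:: (1, Node t (Leaf x))]
  | Node l r =>
      let w0 s := (nleaves s)%:R - alpha in
      let w1 s := (nleaves s)%:R - 1 + theta in
      let wl := if (minlabel l < minlabel r)%N then w1 l else w0 l in
      let wr := if (minlabel l < minlabel r)%N then w0 r else w1 r in
      let w := alpha + wl + wr in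
      (alpha / w, Node t (Leaf x))
      :: [seq (wl / w * p.1, Node p.2 r) | p <- growths alpha theta x l]
      ++ [seq (wr / w * p.1, Node l p.2) | p <- growths alpha theta x r]
  end.

(* The conditional probability that T_{n+1} = u given that T_n = t. *)
Definition growth_prob (R : realType) (alpha theta : R) (n : nat)
    (t u : ltree) : R :=
  \sum_(p <- growths alpha theta n.+1 (repr t) | \pi_(ltree) p.2 == u) p.1.

(* [T n] is only meaningful for n >= 1. *)
Definition growth_process (R : realType) (d : measure_display)
    (Omega : measurableType d) (P : probability Omega R) (alpha theta : R)
    (T : nat -> {RV P >-> ltree}) : Prop :=
  [/\ P [set w | T 1%N w = npleaf 1%N] = 1%E,
      P [set w | T 2%N w = npY 1%N 2%N] = 1%E
    & forall (n : nat) (t : nat -> ltree) (u : ltree), (2 <= n)%N ->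
      P [set w | (forall k, (1 <= k <= n)%N -> T k w = t k) /\ T n.+1 w = u]
      = (P [set w | forall k, (1 <= k <= n)%N -> T k w = t k]
         * (growth_prob alpha theta n (t n) u)%:E)%E].

(* The values outside [n] of a permutation s of [n] are irrelevant. *)
Definition exchangeable_labels (R : realType) (d : measure_display)
    (Omega : measurableType d) (P : probability Omega R) (n : nat)
    (X : {RV P >-> ltree}) : Prop :=
  forall s : nat -> nat, perm_eq [seq s i | i <- iota 1 n] (iota 1 n) ->
  forall t : ltree,
    P [set w | relabel s (X w) = t] = P [set w | X w = t].

(* One entry per leaf of t: the tree obtained by removing this leaf. The tree *)
(* with a single leaf has no entry.                                           *)
Fixpoint prunings (A : Type) (t : tree A) : seq (tree A) :=
  match t with
  | Leaf _ => [::]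
  | Node l r =>
      (if l is Leaf _ then [:: r] else [seq Node l' r | l' <- prunings l])
      ++ (if r is Leaf _ then [:: l] else [seq Node l r' | r' <- prunings r])
  end.

Definition pruning_prob (R : realType) (t s : utree) : R :=
  (count (fun s' => \pi_(utree) s' == s) (prunings (repr t)))%:R
  / (nleaves (repr t))%:R.

Section SamplingConsistency.
Context (R : realType) (d : measure_display) (Omega : measurableType d).
Context (P : probability Omega R) (S : nat -> Omega -> utree).
Local Open Scope ereal_scope.

(* For S the process of delabeled trees, the joint law of S_{n+1} after the   *)
(* removal of a uniform random leaf, at s, and of S_{n+1}, at t.              *)
Definition pruned_joint_law (n : nat) (s t : utree) : \bar R :=
  P [set w | S n.+1 w = t] * (pruning_prob R t s)%:E.

Definition pruned_law (n : nat) (s : utree) : \bar R :=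
  \esum_(t in [set: utree]) pruned_joint_law n s t.

Definition weakly_sampling_consistent : Prop :=
  forall n : nat, (1 <= n)%N -> forall s : utree,
    P [set w | S n w = s] = pruned_law n s.

Definition strongly_sampling_consistent : Prop :=
  forall n : nat, (1 <= n)%N -> forall s t : utree,
    P [set w | S n w = s /\ S n.+1 w = t] = pruned_joint_law n s t.

End SamplingConsistency.

(* The functions above that are defined through representatives do not depend *)
(* on their choice (for growth_prob, on trees with distinct labels).          *)
Section WellDefined.

Lemma pi_iso (A : choiceType) (t u : tree A) :
  (\pi_(nptree A) t == \pi_(nptree A) u) = iso t u.
Proof. exact: (@eqmodE _ (iso_equiv A)). Qed.

Lemma repr_iso (A : choiceType) (t : tree A) :
  iso (repr (\pi_(nptree A) t)) t.
Proof. by rewrite -pi_iso reprK. Qed.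

Lemma iso_tmap (A B : eqType) (f : A -> B) (t u : tree A) :
  iso t u -> iso (tmap f t) (tmap f u).
Proof.
elim: t u => [a|l IHl r IHr] [b|l' r'] //=; first by move=> /eqP->.
by move=> /orP[]/andP[/IHl-> /IHr->]; rewrite ?orbT.
Qed.

Lemma relabel_pi (A B : choiceType) (f : A -> B) (t : tree A) :
  relabel f (\pi_(nptree A) t) = \pi_(nptree B) (tmap f t).
Proof. by apply/eqP; rewrite pi_iso iso_tmap// repr_iso. Qed.

Lemma iso_labels (A : eqType) (t u : tree A) :
  iso t u -> perm_eq (labels t) (labels u).
Proof.
elim: t u => [a|l IHl r IHr] [b|l' r'] //=; first by move=> /eqP->.
move=> /orP[]/andP[/IHl hl /IHr hr]; first exact: perm_cat.
by rewrite perm_sym perm_catC perm_sym perm_cat.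
Qed.

Lemma iso_nleaves (A : eqType) (t u : tree A) :
  iso t u -> nleaves t = nleaves u.
Proof. by move=> /iso_labels/perm_size. Qed.

Lemma iso_minlabel (t u : tree nat) : iso t u -> minlabel t = minlabel u.
Proof.
elim: t u => [a|l IHl r IHr] [b|l' r'] //=; first by move=> /eqP->.
by move=> /orP[]/andP[/IHl-> /IHr->] //; rewrite minnC.
Qed.

Lemma minlabel_in (t : tree nat) : minlabel t \in labels t.
Proof.
elim: t => [a|l IHl r IHr] /=; first exact: mem_head.
by rewrite mem_cat /minn; case: ifP; rewrite (IHl, IHr) ?orbT.
Qed.

Lemma growths_iso (R : realType) (alpha theta : R) (x : nat) (t u : tree nat)
    (F : tree nat -> R) :
  (forall v v', iso v v' -> F v = F v') -> uniq (labels t) -> iso t u ->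
  \sum_(p <- growths alpha theta x t) p.1 * F p.2
  = \sum_(p <- growths alpha theta x u) p.1 * F p.2.
Proof.
elim: t u F => [a|l IHl r IHr] [b|l' r'] //= F HF.
  by move=> _ /eqP->.
rewrite cat_uniq => /and3P[ul /hasPn dlr ur].
have neq_lr : minlabel l != minlabel r.
  apply: contraNN (dlr _ (minlabel_in r)) => /eqP<-; exact: minlabel_in.
have big_scale (c : R) (s : seq (R * tree nat)) (G : R * tree nat -> R) :
    \sum_(p <- s) c * p.1 * G p = c * \sum_(p <- s) p.1 * G p.
  by rewrite mulr_sumr; apply: eq_bigr => p _; rewrite mulrA.
have Hroot v v' : iso v v' -> F (Node v (Leaf x)) = F (Node v' (Leaf x)).
  by move=> vv'; apply: HF; rewrite /= vv' eqxx.
move=> iso_tu; rewrite !big_cons !big_cat !big_map /=.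
have := Hroot (Node l r) (Node l' r') iso_tu => ->.
case/orP: iso_tu => /andP[il ir].
  rewrite (iso_nleaves il) (iso_nleaves ir).
  rewrite (iso_minlabel il) (iso_minlabel ir).
  congr (_ + (_ + _)); rewrite !big_scale; congr (_ * _).
    rewrite (IHl l' (fun v => F (Node v r))) //.
      by apply: eq_bigr => p _; congr (_ * _); apply: HF; rewrite /= iso_refl ir.
    by move=> v v' vv'; apply: HF; rewrite /= iso_refl vv'.
  rewrite (IHr r' (fun v => F (Node l v))) //.
    by apply: eq_bigr => p _; congr (_ * _); apply: HF; rewrite /= iso_refl il.
  by move=> v v' vv'; apply: HF; rewrite /= iso_refl vv'.
rewrite (iso_nleaves il) (iso_nleaves ir).
rewrite -(iso_minlabel il) -(iso_minlabel ir).
have -> : (minlabel r < minlabel l)%N = ~~ (minlabel l < minlabel r)%N.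
  by rewrite -leqNgt [RHS]leq_eqVlt eq_sym (negPf neq_lr).
rewrite !if_neg -!addrA.
rewrite [X in alpha + X]addrC.
congr (_ + _); rewrite [RHS]addrC.
congr (_ + _); rewrite !big_scale; congr (_ * _).
  rewrite (IHl r' (fun v => F (Node v r))) //.
    apply: eq_bigr => p _; congr (_ * _); apply: HF.
    by rewrite /= iso_refl ir orbT.
  by move=> v v' vv'; apply: HF; rewrite /= iso_refl vv'.
rewrite (IHr l' (fun v => F (Node l v))) //.
  apply: eq_bigr => p _; congr (_ * _); apply: HF.
  by rewrite /= iso_refl il orbT.
by move=> v v' vv'; apply: HF; rewrite /= iso_refl vv'.
Qed.

Lemma growth_prob_pi (R : realType) (alpha theta : R) (n : nat)
    (t : tree nat) (u : ltree) : uniq (labels t) ->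
  growth_prob alpha theta n (\pi_(ltree) t) u
  = \sum_(p <- growths alpha theta n.+1 t | \pi_(ltree) p.2 == u) p.1.
Proof.
move=> ut; rewrite /growth_prob.
have E (s : seq (R * tree nat)) : \sum_(p <- s | \pi_(ltree) p.2 == u) p.1
    = \sum_(p <- s) p.1 * (\pi_(ltree) p.2 == u)%:R.
  by rewrite big_mkcond; apply: eq_bigr => p _; case: eqP; rewrite (mulr1, mulr0).
rewrite !E; apply: (growths_iso _ _ _ (F := fun v => (\pi_(ltree) v == u)%:R)).
- by move=> v v'; rewrite -pi_iso => /eqP->.
- by rewrite (perm_uniq (iso_labels (repr_iso t))).
- exact: repr_iso.
Qed.

Lemma prunings_iso (A : eqType) (t u : tree A) (F : tree A -> nat) :
  (forall v v', iso v v' -> F v = F v') -> iso t u ->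
  (\sum_(v <- prunings t) F v = \sum_(v <- prunings u) F v)%N.
Proof.
pose G (l r : tree A) (K : tree A -> tree A) :=
  if l is Leaf _ then [:: r] else [seq K l' | l' <- prunings l].
elim: t u F => [a|l IHl r IHr] [b|l' r'] //= F HF iso_tu.
rewrite !big_cat /=.
have step (c c' s s' : tree A) (K K' : tree A -> tree A) :
    (forall u0 (F0 : tree A -> nat), (forall v v', iso v v' -> F0 v = F0 v') ->
       iso c u0 ->
       \sum_(v <- prunings c) F0 v = \sum_(v <- prunings u0) F0 v)%N ->
    iso c c' -> iso s s' ->
    (forall v v', iso v v' -> iso (K v) (K v')) ->
    (forall v, iso (K v) (K' v)) ->
    (\sum_(v <- G c s K) F v = \sum_(v <- G c' s' K') F v)%N.
  move=> IH cc' ss' HK HKK'.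
  have HG : (\sum_(v <- prunings c) F (K v) = \sum_(v <- prunings c') F (K' v))%N.
    rewrite (IH c' (F \o K)) //=; last by move=> v v' /HK/HF.
    by apply: eq_bigr => v _; apply: HF.
  move: cc' HG; rewrite /G; case: c {IH} => [a|c1 c2]; case: c' => [b|c1' c2'] //.
    by move=> _ _; rewrite !big_seq1; apply: HF.
  by move=> _; rewrite !big_map.
case/orP: iso_tu => /andP[il ir].
  congr addn.
    apply: (step l l' r r' (fun v => Node v r) (fun v => Node v r')) => //.
      by move=> v v' vv'; rewrite /= vv' iso_refl.
    by move=> v; rewrite /= ir iso_refl.
  apply: (step r r' l l' (Node l) (Node l')) => //.
    by move=> v v' vv'; rewrite /= vv' iso_refl.
  by move=> v; rewrite /= il iso_refl.
rewrite [RHS]addnC; congr addn.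
  apply: (step l r' r l' (fun v => Node v r) (Node l')) => //.
    by move=> v v' vv'; rewrite /= vv' iso_refl.
  by move=> v; rewrite /= ir iso_refl orbT.
apply: (step r l' l r' (Node l) (fun v => Node v r')) => //.
  by move=> v v' vv'; rewrite /= vv' iso_refl.
by move=> v; rewrite /= il iso_refl orbT.
Qed.

Lemma pruning_prob_pi (R : realType) (t : tree unit) (s : utree) :
  pruning_prob R (\pi_(utree) t) s
  = (count (fun s' => \pi_(utree) s' == s) (prunings t))%:R / (nleaves t)%:R.
Proof.
rewrite /pruning_prob (iso_nleaves (repr_iso t)) -!sumn_count !sumnE !big_map.
congr (_%:R / _).
apply: (prunings_iso (F := fun v => nat_of_bool (\pi_(utree) v == s))).
  by move=> v v'; rewrite -pi_iso => /eqP->.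
exact: repr_iso.
Qed.

End WellDefined.

(* Main.v *)
Require Import Defs.
From mathcomp Require Import all_boot all_order all_algebra generic_quotient.
From mathcomp Require Import all_classical all_reals all_analysis.
From mathcomp Require Import zify ring lra.

(** Every new label is larger than the old ones, so the subtree of a branch
    point that contains the smallest label never changes its role. Drawing it
    on the left turns the delabeled tree into a Markov chain on planar shapes,
    with kernel [shape_growths]. The law of this chain is a product, over the
    branch points, of the probabilities [split_pr a b] that the two subtrees
    have a and b leaves: this is checked one predecessor at a time, by
    transposing the kernel ([shape_growths_cuts], [branching_cuts]). On functions
    of the non-planar shape this product may be replaced by the product law f of
    the symmetrized rule [symm split_pr] ([sum_branching_sym]).

    Insertion and removal of a leaf are transposed operations on planar trees:
    a planar tree s is obtained from t by removing a leaf as many times as t is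
    obtained from s by attaching a leaf on the left or on the right of an edge
    ([count_inserts]). Hence removing a uniform leaf from a tree of law f
    gives s with probability the sum of f over the insertions into s, divided
    by the number of leaves.

    Weak consistency. By induction on s, that sum is what consistency asks as
    soon as the symmetrized rule satisfies one quadratic identity
    ([sum_inserts_branching]). For theta = 1 - alpha and for theta = 2 - alpha
    the rule has a product form, and both values give the same symmetrized
    rule, which satisfies the identity ([closed_consistent]). Conversely,
    consistency at the balanced tree with four leaves is a polynomial equation
    whose left-hand side is (theta - 1 + alpha) (theta - 2 + alpha) times a
    positive factor.

    Strong consistency. If no subtree of s at its first branch point is a leaf,
    then the tree t with subtrees s and a leaf arises from s only through the
    root edge, and s from t only by removing that leaf. Equating the two
    probabilities ([strongly_consistent_graft]) for such trees s with four and
    with five leaves forces alpha = theta = 1/2. At this point all edges are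
    selected with the same probability and f is constant on the planar shapes
    of a given size ([branching_half]), so transposing insertions and removals
    turns one joint law into the other.

    Exchangeability. The three trees with leaves 1, 2, 3 have probabilities
    proportional to alpha, theta and 1 - alpha, hence the necessity. At
    alpha = theta = 1/2 the law of the tree is the image of the uniform law on
    the planar trees with these labels, each of which is produced exactly once
    by successive insertions ([count_planar_trees]), and relabelling permutes
    these planar trees. *)

Set Implicit Arguments.
Unset Strict Implicit.
Unset Printing Implicit Defensive.

Import Order.TTheory GRing.Theory Num.Theory.

Local Open Scope ring_scope.

(** * Insertion and removal of leaves in planar trees *)

Lemma nleaves_Node (A : Type) (l r : tree A) : nleaves (Node l r) = (nleaves l + nleaves r)%N.
Proof. by rewrite /nleaves /= size_cat. Qed.

Lemma nleaves_gt0 (A : Type) (t : tree A) : (0 < nleaves t)%N.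
Proof. by elim: t => // l IHl r IHr; rewrite nleaves_Node addn_gt0 IHl. Qed.

Lemma nleaves_ltl (A : Type) (l r : tree A) : (nleaves l < nleaves (Node l r))%N.
Proof. by rewrite nleaves_Node -addn1 leq_add2l nleaves_gt0. Qed.

Lemma nleaves_ltr (A : Type) (l r : tree A) : (nleaves r < nleaves (Node l r))%N.
Proof. by rewrite nleaves_Node -add1n leq_add2r nleaves_gt0. Qed.

Lemma nleaves_Node_gt1 (A : Type) (l r : tree A) : (1 < nleaves (Node l r))%N.
Proof. exact: leq_ltn_trans (nleaves_gt0 l) (nleaves_ltl l r). Qed.

Lemma nleaves_Node1 (A : Type) (t : tree A) a : nleaves (Node t (Leaf a)) = (nleaves t).+1.
Proof. by rewrite nleaves_Node -[RHS]addn1. Qed.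

Lemma eqLeaf (t : tree unit) : (t == Leaf tt) = (nleaves t == 1%N).
Proof.
case: t => [[]|l r]; first by rewrite !eqxx.
by rewrite [RHS]gtn_eqF ?nleaves_Node_gt1.
Qed.

Lemma iso_swap (A : eqType) (l r : tree A) : iso (Node l r) (Node r l).
Proof. by rewrite /= !iso_refl orbT. Qed.

Section PlanarTrees.
Variable A : choiceType.
Implicit Types (x : A) (s t l r : tree A).

Lemma eqNode l r l' r' : (Node l r == Node l' r') = (l == l') && (r == r').
Proof. by apply/eqP/andP => [[-> ->]|[/eqP-> /eqP->]]. Qed.

(** Each edge contributes two trees, with the new leaf on either side: with both
    sides counted, insertion becomes the exact transpose of removal. *)
Fixpoint inserts x s : seq (tree A) :=
  [:: Node (Leaf x) s, Node s (Leaf x)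
   & if s is Node l r
     then [seq Node l' r | l' <- inserts x l] ++ [seq Node l r' | r' <- inserts x r]
     else [::]].

(** Removing one leaf labelled x, with one entry per such leaf. Over the unit
    labels this is [prunings] up to order, see [perm_prunings]. *)
Fixpoint cuts x t : seq (tree A) :=
  if t is Node l r then
    (if l == Leaf x then [:: r] else [::]) ++ (if r == Leaf x then [:: l] else [::])
    ++ [seq Node l' r | l' <- cuts x l] ++ [seq Node l r' | r' <- cuts x r]
  else [::].

Lemma count_Nodel l r r' (ls : seq (tree A)) :
  count_mem (Node l r) [seq Node l' r' | l' <- ls] = ((r' == r) * count_mem l ls)%N.
Proof.
rewrite count_map; case: eqVneq => [->|ne]; rewrite ?mul1n ?mul0n.
  by apply: eq_count => l' /=; rewrite eqNode eqxx andbT.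
rewrite -(count_pred0 ls); apply: eq_count => l' /=.
by rewrite eqNode (negPf ne) andbF.
Qed.

Lemma count_Noder l r l' (rs : seq (tree A)) :
  count_mem (Node l r) [seq Node l' r' | r' <- rs] = ((l' == l) * count_mem r rs)%N.
Proof.
rewrite count_map; case: eqVneq => [->|ne]; rewrite ?mul1n ?mul0n.
  by apply: eq_count => r' /=; rewrite eqNode eqxx.
rewrite -(count_pred0 rs); apply: eq_count => r' /=.
by rewrite eqNode (negPf ne).
Qed.

(** The recursions of [inserts], on the smaller tree, and of [cuts], on the larger
    one, compare the same subtrees: a new leaf is either a child of the first
    branch point, or lies in one of its subtrees while the other one is unchanged. *)
Lemma count_inserts x s t : count_mem t (inserts x s) = count_mem s (cuts x t).
Proof.
elim: t s => [a|l IHl r IHr] s.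
  by case: s => [b|l r] //=; rewrite count_cat !count_map !count_pred0.
have root : (count_mem s (if l == Leaf x then [:: r] else [::])
   + count_mem s (if r == Leaf x then [:: l] else [::])
   = (Node (Leaf x) s == Node l r) + (Node s (Leaf x) == Node l r))%N.
  rewrite !eqNode [Leaf x == l]eq_sym [Leaf x == r]eq_sym [s == l]eq_sym [s == r]eq_sym.
  by do 2!case: (_ == Leaf x); rewrite /= ?andbT ?andbF ?addn0 ?add0n.
rewrite /= !count_cat addnA root; case: s {root} => [b|s1 s2] /=.
  by rewrite addnA !count_map !count_pred0.
rewrite count_cat !count_Nodel !count_Noder IHl IHr [s2 == _]eq_sym [s1 == _]eq_sym.
by rewrite addnA.
Qed.

Lemma inserts_labels x s t :
  t \in inserts x s -> perm_eq (labels t) (x :: labels s).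
Proof.
elim: s t => [a|l IHl r IHr] t; rewrite !inE /=.
  by move=> /orP[] /eqP->; rewrite //= (perm_catC [:: a] [:: x]).
case/or3P => [/eqP->|/eqP->|] //=; first by rewrite perm_catC.
rewrite mem_cat => /orP[] /mapP[t' ht' ->] /=.
  by rewrite -cat_cons perm_cat2r IHl.
rewrite (perm_trans (y := labels l ++ (x :: labels r))) ?perm_cat2l ?IHr //.
by rewrite -[x :: labels r]cat1s perm_catCA.
Qed.

Lemma cuts_labels x t s :
  s \in cuts x t -> perm_eq (labels t) (x :: labels s).
Proof.
by rewrite -has_pred1 has_count -count_inserts -has_count has_pred1 => /inserts_labels.
Qed.

Lemma size_cuts x t :
  (1 < nleaves t)%N -> size (cuts x t) = count_mem x (labels t).
Proof.
have eqL (s : tree A) : ~~ (1 < nleaves s)%N -> exists a, s = Leaf a.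
  case: s => [a|s1 s2]; first by exists a.
  by rewrite nleaves_Node; move: (nleaves_gt0 s1) (nleaves_gt0 s2); lia.
elim: t => //= l IHl r IHr _; rewrite !size_cat !size_map count_cat.
have side (s s' : tree A) : ((1 < nleaves s)%N -> size (cuts x s) = count_mem x (labels s)) ->
    (size (if s == Leaf x then [:: s'] else [::]) + size (cuts x s) = count_mem x (labels s))%N.
  case: (ltnP 1 (nleaves s)) => [h /(_ isT) -> |].
    by case: eqP h => // ->.
  rewrite leqNgt => /eqL[a ->] _ /=.
  have -> : (Leaf a == Leaf x) = (a == x) by apply/eqP/eqP => [[]|->].
  by case: (a == x).
by rewrite -(side l r IHl) -(side r l IHr); lia.
Qed.

End PlanarTrees.

Lemma perm_prunings (t : tree unit) : perm_eq (prunings t) (cuts tt t).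
Proof.
elim: t => //= l IHl r IHr.
have eqLu (s : tree unit) : (s == Leaf tt) = if s is Leaf _ then true else false.
  by case: s => [[]|s1 s2]; rewrite ?eqxx.
apply/permP => a; rewrite !eqLu.
move/(perm_map (fun l' => Node l' r))/permP/(_ a): IHl => hl.
move/(perm_map (Node l))/permP/(_ a): IHr => hr.
rewrite !count_cat -hl -hr.
by case: l {hl hr} => [[]|l1 l2]; case: r => [[]|r1 r2] /=; rewrite ?addn0 ?add0n // addnC.
Qed.

Lemma sum_by_value (R : realType) (V : eqType) (W : seq V) (D : seq (R * V)) (F : V -> R) :
  uniq W -> {in D, forall p, p.2 \in W} ->
  \sum_(p <- D) p.1 * F p.2 = \sum_(v <- W) (\sum_(p <- D | p.2 == v) p.1) * F v.
Proof.
move=> uW DW.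
under [RHS]eq_bigr do rewrite big_distrl /= big_mkcond.
rewrite exchange_big /= [LHS]big_seq [RHS]big_seq; apply: eq_bigr => p /DW pW.
rewrite (bigD1_seq p.2) //= eqxx big1 ?addr0 // => v.
by rewrite eq_sym => /negPf->.
Qed.

Lemma sum_by_value_count (R : realType) (V : eqType) (W D : seq V) (F : V -> R) :
  uniq W -> {subset D <= W} ->
  \sum_(v <- D) F v = \sum_(v <- W) (count_mem v D)%:R * F v.
Proof.
move=> uW DW.
have := @sum_by_value R V W [seq (1, v) | v <- D] F uW.
rewrite big_map; under eq_bigr do rewrite /= mul1r.
move=> ->; last by move=> _ /mapP[v /DW vW ->].
apply: eq_bigr => v _; congr (_ * _).
by rewrite big_map -sum1_count natr_sum.
Qed.

(** Bounding the height rather than the number of leaves makes the recursion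
    structural and lets sums over branch points factor as double sums. *)
Fixpoint trees h : seq (tree unit) :=
  Leaf tt :: if h is h'.+1 then [seq Node l r | l <- trees h', r <- trees h'] else [::].

Lemma trees_uniq h : uniq (trees h).
Proof.
elim: h => //= h IH; apply/andP; split.
  by apply/negP => /allpairsP[[l r] [_ _]].
by apply: allpairs_uniq => // -[a b] [c d] _ _ /= [-> ->].
Qed.

Lemma mem_trees h t : (nleaves t <= h.+1)%N -> t \in trees h.
Proof.
elim: h t => [|h IH] [[]|l r]; rewrite ?inE //= => le.
  by have := leq_trans (nleaves_Node_gt1 l r) le.
by apply: allpairs_f; apply: IH; rewrite -ltnS (leq_trans _ le) // ?nleaves_ltl ?nleaves_ltr.
Qed.

Definition shapes n := [seq t <- trees n | nleaves t == n].

Lemma shapes_uniq n : uniq (shapes n).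
Proof. exact/filter_uniq/trees_uniq. Qed.

Lemma mem_shapes n t : (t \in shapes n) = (nleaves t == n).
Proof. by rewrite mem_filter; case: eqP => // <-; rewrite mem_trees. Qed.

Lemma inserts_nleaves (A : choiceType) (x : A) (s t : tree A) :
  t \in inserts x s -> nleaves t = (nleaves s).+1.
Proof. by move/inserts_labels/perm_size. Qed.

Lemma prunings_nleaves (s t : tree unit) :
  s \in prunings t -> nleaves t = (nleaves s).+1.
Proof. by rewrite (perm_mem (perm_prunings t)) => /cuts_labels/perm_size. Qed.

(** This is how removing a random leaf is computed: the transposition
    [count_inserts], summed over all pairs of shapes. *)
Lemma sum_prunings (R : realType) n (F : tree unit -> tree unit -> R) :
  \sum_(t <- shapes n.+1) \sum_(s <- prunings t) F s t
  = \sum_(s <- shapes n) \sum_(t <- inserts tt s) F s t.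
Proof.
transitivity (\sum_(t <- shapes n.+1) \sum_(s <- shapes n)
    (count_mem s (prunings t))%:R * F s t).
  apply: eq_big_seq => t; rewrite mem_shapes => /eqP nt.
  apply: (sum_by_value_count (fun s => F s t) (shapes_uniq n)) => s /prunings_nleaves.
  by rewrite mem_shapes nt => -[->].
rewrite exchange_big; apply: eq_big_seq => s; rewrite mem_shapes => /eqP ns /=.
rewrite (sum_by_value_count (F s) (shapes_uniq n.+1)).
  apply: eq_bigr => t _; congr (_%:R * _).
  by rewrite count_inserts (permP (perm_prunings t)).
by move=> t /inserts_nleaves; rewrite mem_shapes ns => ->.
Qed.

(** * Markov branching laws on planar shapes *)

Section MarkovBranching.
Variable R : realType.

(** The law of the random shape whose branch points split independently, q a b
    being the probability that a + b leaves split into a on the left and b on the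
    right. *)
Fixpoint branching (q : nat -> nat -> R) (t : tree unit) : R :=
  if t is Node l r then q (nleaves l) (nleaves r) * (branching q l * branching q r) else 1.

Definition symm (q : nat -> nat -> R) a b := (q a b + q b a) / 2.

(** A function of the non-planar shape does not see an exchange of the subtrees:
    once the laws of both subtrees are symmetrized by induction, the sum at the
    first branch point equals its average with the exchanged sum. *)
Lemma sum_trees_branching_sym q h (F : tree unit -> R) :
  (forall t u, iso t u -> F t = F u) ->
  \sum_(t <- trees h) branching q t * F t
  = \sum_(t <- trees h) branching (symm q) t * F t.
Proof.
elim: h F => [|h IH] F iF /=; first by rewrite !big_seq1.
rewrite !big_cons !big_allpairs_dep /=; congr (_ + _).
transitivity (\sum_(l <- trees h) \sum_(r <- trees h)
   branching (symm q) l * (branching (symm q) r * (q (nleaves l) (nleaves r) * F (Node l r)))).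
  transitivity (\sum_(l <- trees h) branching q l * (\sum_(r <- trees h)
     branching (symm q) r * (q (nleaves l) (nleaves r) * F (Node l r)))).
    apply: eq_bigr => l _; rewrite mulr_sumr.
    transitivity (branching q l * \sum_(r <- trees h)
        branching q r * (q (nleaves l) (nleaves r) * F (Node l r))).
      by rewrite mulr_sumr; apply: eq_bigr => r _; ring.
    rewrite -mulr_sumr; congr (_ * _).
    apply: IH => t u tu; rewrite (iso_nleaves tu); congr (_ * _).
    by apply: iF; rewrite /= iso_refl tu.
  rewrite IH; first by apply: eq_bigr => l _; rewrite mulr_sumr.
  move=> t u tu; apply: eq_bigr => r _; rewrite (iso_nleaves tu) (iF _ (Node u r)) //.
  by rewrite /= iso_refl tu.
(* average the double sum with the one where l and r are exchanged *)
set S := LHS; have S2 : S = (S + S) / 2 by field.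
rewrite {}S2 {2}/S exchange_big -big_split mulr_suml; apply: eq_bigr => l _.
rewrite -big_split mulr_suml; apply: eq_bigr => r _ /=.
by rewrite (iF _ _ (iso_swap r l)) /symm; field.
Qed.

Lemma sum_shapes (F : tree unit -> R) n :
  \sum_(t <- shapes n) F t = \sum_(t <- trees n) (nleaves t == n)%:R * F t.
Proof.
rewrite big_filter big_mkcond; apply: eq_bigr => t _.
by case: eqP; rewrite (mul1r, mul0r).
Qed.

Lemma sum_branching_sym q n (F : tree unit -> R) :
  (forall t u, iso t u -> F t = F u) ->
  \sum_(t <- shapes n) branching q t * F t
  = \sum_(t <- shapes n) branching (symm q) t * F t.
Proof.
move=> iF; rewrite !sum_shapes.
under eq_bigr do rewrite mulrCA; under [RHS]eq_bigr do rewrite mulrCA.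
apply: sum_trees_branching_sym => t u tu.
by rewrite (iF _ _ tu) (iso_nleaves tu).
Qed.

End MarkovBranching.

Section ShapeChain.
Variables (R : realType) (alpha theta : R).
Hypothesis (theta_ge0 : 0 <= theta).

(** The probability that, in a tree with n + 2 leaves, the subtree without the
    smallest label has j + 1 leaves. In a growth step, the root edge makes this
    size 1, and otherwise the new leaf falls in one of the two subtrees. *)
Fixpoint split_law n j : R :=
  if n is m.+1 then
    ((if j is 0%N then alpha else 0) + split_law m j * ((m - j)%:R + theta)
     + (if j is i.+1 then split_law m i * (j%:R - alpha) else 0)) / (m.+1%:R + theta)
  else (j == 0)%:R.

(** The left subtree, with a leaves, is the one with the smallest label. *)
Definition split_pr a b := split_law (a + b - 2) b.-1.

Definition root_pr n := if n == 1%N then 1 else alpha / (n%:R - 1 + theta).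
Definition left_pr a b := (a%:R - 1 + theta) / ((a + b)%:R - 1 + theta).
Definition right_pr a b := (b%:R - alpha) / ((a + b)%:R - 1 + theta).

Lemma split_law_out n j : (n < j)%N -> split_law n j = 0.
Proof.
elim: n j => [|n IH] [|j] //= lt.
by rewrite !IH ?mul0r ?add0r ?mul0r //; lia.
Qed.

Lemma den_gt0 n : 0 < n.+1%:R + theta.
Proof. by rewrite ltr_wpDr. Qed.

Lemma split_prS i j : split_pr i.+1 j.+1 = split_law (i + j) j.
Proof. by rewrite /split_pr; congr split_law; lia. Qed.

Lemma split_lawS m j : split_law m.+1 j =
  ((if j is 0%N then alpha else 0) + split_law m j * ((m - j)%:R + theta)
     + (if j is i.+1 then split_law m i * (j%:R - alpha) else 0)) / (m.+1%:R + theta).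
Proof. by []. Qed.

(** The recursion of [split_law] in terms of the two sizes, in the form needed to
    sum over the predecessors of a shape. *)
Lemma split_pr_rec a b : (0 < a)%N -> (0 < b)%N ->
  split_pr a b = (if b == 1%N then root_pr a else 0)
   + (if (1 < a)%N then left_pr a.-1 b * split_pr a.-1 b else 0)
   + (if (1 < b)%N then right_pr a b.-1 * split_pr a b.-1 else 0).
Proof.
have predR n : n.+1%:R - 1 = n%:R :> R by rewrite -natr1 addrK.
case: a b => [//|[|i]] [//|[|j]] _ _; rewrite /root_pr /left_pr /right_pr.
- by rewrite !addr0.
- rewrite !split_prS /= add0n (@split_law_out j) // add1n predR mul0r !add0r.
  by rewrite [RHS]mulrC mulrA.
- rewrite !split_prS /= addn0 addn1 !predR addr0 subn0 addr0.
  by have := den_gt0 i; move: (_ + theta) => D D0; field; rewrite gt_eqF.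
- rewrite [split_pr i.+2 j.+1]lock [split_pr i.+1 j.+2]lock /= -!lock !split_prS.
  rewrite !add0r !addnS !addSn split_lawS !predR add0r.
  rewrite (_ : (i + j).+1 - j.+1 = i)%N; last by lia.
  have := den_gt0 (i + j).+1; move: (_ + theta) (split_law _.+1 j) => D S D0.
  by field; rewrite gt_eqF.
Qed.

(** The growth step on planar shapes in which the subtree with the smallest label
    is on the left. *)
Fixpoint shape_growths (t : tree unit) : seq (R * tree unit) :=
  (root_pr (nleaves t), Node t (Leaf tt)) ::
  if t is Node l r then
    [seq (left_pr (nleaves l) (nleaves r) * p.1, Node p.2 r) | p <- shape_growths l]
    ++ [seq (right_pr (nleaves l) (nleaves r) * p.1, Node l p.2) | p <- shape_growths r]
  else [::].

(** The transposed kernel: one entry per way in which a growth step may produce t,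
    with the probability of this step. *)
Fixpoint shape_cuts (t : tree unit) : seq (R * tree unit) :=
  if t is Node l r then
    (if r == Leaf tt then [:: (root_pr (nleaves l), l)] else [::])
    ++ [seq (left_pr (nleaves p.2) (nleaves r) * p.1, Node p.2 r) | p <- shape_cuts l]
    ++ [seq (right_pr (nleaves l) (nleaves p.2) * p.1, Node l p.2) | p <- shape_cuts r]
  else [::].

Lemma shape_growths_cuts s t :
  \sum_(p <- shape_growths s | p.2 == t) p.1 = \sum_(p <- shape_cuts t | p.2 == s) p.1.
Proof.
elim: t s => [[]|l IHl r IHr] s.
  rewrite big_nil; case: s => [[]|s1 s2]; rewrite /= ?big_cons ?big_nil //=.
  by rewrite big_cat !big_map /= !big_pred0_eq addr0.
have root : \sum_(p <- if r == Leaf tt then [:: (root_pr (nleaves l), l)] else [::] | p.2 == s) p.1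
    = if Node s (Leaf tt) == Node l r then root_pr (nleaves s) else 0.
  rewrite eqNode andbC eq_sym; case: eqP => _ /=; last by rewrite big_nil.
  by rewrite big_cons big_nil /= eq_sym addr0; case: eqP => [->|].
rewrite [RHS]big_cat root /= {root}; case: s => [[]|s1 s2] /=.
  rewrite big_cons big_nil /= big_cat !big_map !big1 //= !addr0.
  by case: ifP.
rewrite big_cons !big_cat !big_map /=.
transitivity ((if Node (Node s1 s2) (Leaf tt) == Node l r then root_pr (nleaves (Node s1 s2)) else 0)
  + ((s2 == r)%:R * left_pr (nleaves s1) (nleaves s2) * \sum_(p <- shape_growths s1 | p.2 == l) p.1
  + (s1 == l)%:R * right_pr (nleaves s1) (nleaves s2) * \sum_(p <- shape_growths s2 | p.2 == r) p.1)).
  have E (x y : R) b : (if b then x + y else y) = (if b then x else 0) + y.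
    by case: b; rewrite ?add0r.
  rewrite E; congr (_ + _); congr (_ + _).
    under eq_bigl do rewrite eqNode andbC.
    by case: eqP => _; rewrite ?mul1r ?mul0r /= ?big_pred0_eq // mulr_sumr.
  under eq_bigl do rewrite eqNode.
  by case: eqP => _; rewrite ?mul1r ?mul0r /= ?big_pred0_eq // mulr_sumr.
congr (_ + _); rewrite IHl IHr; congr (_ + _).
  under [RHS]eq_bigl do rewrite eqNode andbC eq_sym.
  case: eqP => [->|_]; rewrite ?mul1r ?mul0r /= ?big_pred0_eq // mulr_sumr.
  by apply: eq_bigr => p /eqP->.
under [RHS]eq_bigl do rewrite eqNode eq_sym.
case: eqP => [->|_]; rewrite ?mul1r ?mul0r /= ?big_pred0_eq // mulr_sumr.
by apply: eq_bigr => p /eqP->.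
Qed.

Lemma shape_growths_nleaves s p :
  p \in shape_growths s -> nleaves p.2 = (nleaves s).+1.
Proof.
elim: s p => [[]|l IHl r IHr] p; rewrite /= !inE.
  by move/eqP->.
case/orP => [/eqP->|]; first by rewrite nleaves_Node1.
by rewrite mem_cat => /orP[] /mapP[p' hp' ->];
  rewrite /= !nleaves_Node ?(IHl _ hp') ?(IHr _ hp') ?addnS.
Qed.

Lemma shape_cuts_nleaves t p :
  p \in shape_cuts t -> nleaves t = (nleaves p.2).+1.
Proof.
elim: t p => [//|l IHl r IHr] p; rewrite /= !mem_cat => /or3P[|/mapP[p' hp ->]|/mapP[p' hp ->]] /=.
- by case: eqP => // ->; rewrite inE => /eqP->; rewrite nleaves_Node1.
- by rewrite !nleaves_Node (IHl _ hp).
- by rewrite !nleaves_Node (IHr _ hp) addnS.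
Qed.

(** By induction, growth steps inside a subtree turn the law of the smaller
    subtree into that of the larger one, so that only the sizes at the first
    branch point matter, and they obey [split_pr_rec]. *)
Lemma branching_cuts t : (1 < nleaves t)%N ->
  \sum_(p <- shape_cuts t) p.1 * branching split_pr p.2 = branching split_pr t.
Proof.
have cut1 (s : tree unit) : (1 < nleaves s)%N = false -> shape_cuts s = [::].
  case: s => [//|s1 s2]; rewrite nleaves_Node.
  by move: (nleaves_gt0 s1) (nleaves_gt0 s2); lia.
elim: t => [//|l IHl r IHr] _ /=; rewrite !big_cat !big_map /=.
rewrite [in RHS]split_pr_rec ?nleaves_gt0 // !mulrDl -addrA; congr (_ + (_ + _)).
- rewrite eqLeaf; case: eqP => [n1|_]; last by rewrite big_nil mul0r.
  rewrite big_seq1 /=; have /eqP -> : r == Leaf tt by rewrite eqLeaf n1.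
  by rewrite /= mulr1.
- case: ifP => [l1|/cut1->]; last by rewrite big_nil mul0r.
  rewrite -(IHl l1) mulr_suml mulr_sumr; apply: eq_big_seq => p /shape_cuts_nleaves->.
  by rewrite /=; ring.
- case: ifP => [r1|/cut1->]; last by rewrite big_nil mul0r.
  rewrite -(IHr r1) mulr_sumr mulr_sumr; apply: eq_big_seq => p /shape_cuts_nleaves->.
  by rewrite /=; ring.
Qed.

Lemma sum_branching_growths n (F : tree unit -> R) : (0 < n)%N ->
  \sum_(s <- shapes n) branching split_pr s * \sum_(p <- shape_growths s) p.1 * F p.2
  = \sum_(t <- shapes n.+1) branching split_pr t * F t.
Proof.
move=> n0.
transitivity (\sum_(s <- shapes n) \sum_(t <- shapes n.+1)
   (\sum_(p <- shape_cuts t | p.2 == s) p.1) * branching split_pr s * F t).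
  apply: eq_big_seq => s; rewrite mem_shapes => /eqP ns.
  rewrite (sum_by_value F (shapes_uniq n.+1)) ?mulr_sumr.
    by apply: eq_bigr => t _; rewrite shape_growths_cuts mulrCA mulrA.
  by move=> p /shape_growths_nleaves; rewrite mem_shapes ns => ->.
rewrite exchange_big; apply: eq_big_seq => t; rewrite mem_shapes => /eqP nt /=.
rewrite -mulr_suml -(sum_by_value (branching split_pr) (shapes_uniq n)) ?branching_cuts ?nt //.
by move=> p /shape_cuts_nleaves; rewrite mem_shapes nt => -[->].
Qed.

End ShapeChain.

(** * Consistent splitting rules *)

Lemma symmC (R : realType) (q : nat -> nat -> R) a b : symm q a b = symm q b a.
Proof. by rewrite /symm addrC. Qed.

(** With a and b leaves in the subtrees of s, an insertion at the root edge
    multiplies the weight by q 1 (a + b), on either side, and by induction the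
    insertions into the left subtree replace its factor q a b by (a + 1) q (a + 1) b.
    The assumed identity says that all contributions add up to a + b + 1 times the
    weight of s. *)
Lemma sum_inserts_branching (R : realType) (q : nat -> nat -> R) (s : tree unit) :
  q 1%N 1%N = 1 -> (forall a b, q a b = q b a) ->
  (forall a b, (0 < a)%N -> (0 < b)%N ->
     2 * q 1%N (a + b)%N * q a b + a.+1%:R * q a.+1 b + b.+1%:R * q a b.+1
     = (a + b).+1%:R * q a b) ->
  \sum_(t <- inserts tt s) branching q t = (nleaves s).+1%:R * branching q s.
Proof.
move=> q11 qC cons; elim: s => [[]|l IHl r IHr].
  by rewrite /= !big_cons big_nil /= (_ : nleaves (Leaf tt) = 1%N) // q11; ring.
rewrite [inserts _ _]/= !big_cons big_cat !big_map.
transitivity (q 1%N (nleaves l + nleaves r)%N * branching q (Node l r) * 2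
  + ((\sum_(t <- inserts tt l) branching q t) * q (nleaves l).+1 (nleaves r) * branching q r
  + (\sum_(t <- inserts tt r) branching q t) * q (nleaves l) (nleaves r).+1 * branching q l)).
  rewrite addrA; congr (_ + (_ + _)).
  - have br l' r' : branching q (Node l' r') = q (nleaves l') (nleaves r') * (branching q l' * branching q r') by [].
    rewrite (br (Leaf tt)) (br (Node l r)) (_ : nleaves (Leaf tt) = 1%N) // nleaves_Node.
    by rewrite (qC _ 1%N) [branching q (Leaf tt)]/=; ring.
  - rewrite !mulr_suml; apply: eq_big_seq => t /inserts_nleaves nt /=.
    by rewrite nt; ring.
  - rewrite !mulr_suml; apply: eq_big_seq => t /inserts_nleaves nt /=.
    by rewrite nt; ring.
rewrite IHl IHr nleaves_Node /=.
have := cons _ _ (nleaves_gt0 l) (nleaves_gt0 r).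
set Q := q (nleaves l) (nleaves r); set x := branching q l; set y := branching q r.
move=> E; transitivity (x * y * ((nleaves l + nleaves r).+1%:R * Q)); last by ring.
by rewrite -E; ring.
Qed.

Section ClosedForm.
Variables (R : realType) (alpha theta : R).
Hypothesis (alpha_lt1 : alpha < 1) (theta_ge0 : 0 <= theta).

(** With a = i + 1 and b = j + 1, these equations are those of [split_pr_rec], and
    they determine [split_pr]. *)
Lemma split_pr_closed (C : nat -> nat -> R) :
  C 0%N 0%N = 1 ->
  (forall i, C i.+1 0%N = (alpha + (i%:R + theta) * C i 0%N) / (i.+1%:R + theta)) ->
  (forall j, C 0%N j.+1 = (j.+1%:R - alpha) * C 0%N j / (j.+1%:R + theta)) ->
  (forall i j, C i.+1 j.+1 = ((i%:R + theta) * C i j.+1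
      + (j.+1%:R - alpha) * C i.+1 j) / ((i + j).+2%:R + theta)) ->
  forall i j, split_pr alpha theta i.+1 j.+1 = C i j.
Proof.
move=> C00 Ci0 C0j Cij.
have predR n : n.+1%:R - 1 = n%:R :> R by rewrite -natr1 addrK.
suff H n i j : (i + j <= n)%N -> split_pr alpha theta i.+1 j.+1 = C i j.
  by move=> i j; exact: (H (i + j)%N).
elim: n i j => [|n IH] [|i] [|j] le; try by rewrite /split_pr /= C00.
all: rewrite split_pr_rec // [split_pr _ _]lock /= -lock.
- by rewrite add0r IH // add0r C0j /right_pr /= add1n predR mulrAC.
- rewrite addr0  IH; last by lia.
  by rewrite Ci0 /root_pr /left_pr /= addn1 !predR mulrAC -mulrDl.
- rewrite add0r  !IH; try by lia.
  by rewrite Cij /right_pr /left_pr !addSn !addnS !predR [RHS]mulrDl; congr (_ + _); rewrite mulrAC.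
Qed.

(** (1 - alpha) (2 - alpha) ... (i - alpha) / (i + 1)!, the factor of a subtree
    with i + 1 leaves in the closed forms of the splitting rule. *)
Fixpoint rising_ratio i : R :=
  if i is k.+1 then rising_ratio k * ((k.+1%:R - alpha) / k.+2%:R) else 1.

Lemma rising_ratioS i : rising_ratio i.+1 = rising_ratio i * ((i.+1%:R - alpha) / i.+2%:R).
Proof. by []. Qed.

Lemma subalpha_gt0 k : 0 < k.+1%:R - alpha.
Proof. by rewrite subr_gt0 (lt_le_trans alpha_lt1) // ler1n. Qed.

Lemma rising_ratio_gt0 i : 0 < rising_ratio i.
Proof. by elim: i => //= i IH; rewrite mulr_gt0 // divr_gt0 // subalpha_gt0. Qed.

(** The symmetrized rule common to theta = 1 - alpha and theta = 2 - alpha, for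
    subtrees with i + 1 and j + 1 leaves. *)
Definition closed_split i j : R :=
  rising_ratio i * rising_ratio j / rising_ratio (i + j).+1
  * (alpha * (i.+1%:R * i%:R + j.+1%:R * j%:R) + 2 * i.+1%:R * j.+1%:R * (1 - alpha))
  / (2 * (i + j).+2%:R * (i + j).+1%:R).

Lemma symm_split_closed1 : theta = 1 - alpha ->
  forall i j, symm (split_pr alpha theta) i.+1 j.+1 = closed_split i j.
Proof.
move=> th i j; rewrite /symm.
pose C i j := rising_ratio i * rising_ratio j / rising_ratio (i + j).+1
  * (i.+1%:R * (alpha * i%:R + j.+1%:R * (1 - alpha))) / ((i + j).+2%:R * (i + j).+1%:R).
have E : forall i j, split_pr alpha theta i.+1 j.+1 = C i j.
  apply: split_pr_closed; rewrite /C.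
  - by rewrite addn0 /=; have h := subalpha_gt0 0; field; rewrite gt_eqF.
  - move=> {j} {}i; rewrite !addn0 th.
    have h := rising_ratio_gt0 i; have a1 := subalpha_gt0 i; have a2 := subalpha_gt0 i.+1.
    have x0 : 0 <= i%:R :> R by [].
    move: h a1 a2 x0; rewrite /= -!natr1; move: (rising_ratio i) (i%:R) => H x h a1 a2 x0.
    field; rewrite !gt_eqF //; lra.
  - move=> {i} {}j; rewrite !add0n th.
    have h := rising_ratio_gt0 j; have a1 := subalpha_gt0 j; have a2 := subalpha_gt0 j.+1.
    have x0 : 0 <= j%:R :> R by [].
    move: h a1 a2 x0; rewrite /= -!natr1; move: (rising_ratio j) (j%:R) => H x h a1 a2 x0.
    field; rewrite !gt_eqF //; lra.
  - move=> {}i {}j; rewrite !addSn !addnS th.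
    have hi := rising_ratio_gt0 i; have hj := rising_ratio_gt0 j; have hh := rising_ratio_gt0 (i + j).+2.
    have a := subalpha_gt0 (i + j).+2.
    have x0 : 0 <= i%:R :> R by []. have y0 : 0 <= j%:R :> R by [].
    move: hi hj hh a x0 y0; rewrite (rising_ratioS (i + j).+2) (rising_ratioS i) (rising_ratioS j) -!natr1 !natrD.
    move: (rising_ratio i) (rising_ratio j) (rising_ratio (i + j).+2) (i%:R) (j%:R) => H K L x y hi hj hh a x0 y0.
    field; rewrite !gt_eqF //; lra.
rewrite !E /C /closed_split [(j + i)%N]addnC.
have hh := rising_ratio_gt0 (i + j).+1.
have x0 : 0 <= i%:R :> R by []. have y0 : 0 <= j%:R :> R by [].
move: hh x0 y0; rewrite -!natr1 !natrD.
move: (rising_ratio _.+1) (rising_ratio i) (rising_ratio j) (i%:R) (j%:R) => L H K x y hh x0 y0.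
field; rewrite !gt_eqF //; lra.
Qed.

(** Only the rule before symmetrization differs from that of theta = 1 - alpha. *)
Lemma symm_split_closed2 : theta = 2 - alpha ->
  forall i j, symm (split_pr alpha theta) i.+1 j.+1 = closed_split i j.
Proof.
move=> th i j; rewrite /symm.
pose C i j := rising_ratio i * rising_ratio j / rising_ratio (i + j).+1
  * ((i.+1%:R - alpha) / ((i + j).+2%:R - alpha))
  * (i.+1%:R * (alpha * i%:R + j.+1%:R * (2 - alpha))) / ((i + j).+2%:R * (i + j).+1%:R).
have E : forall i j, split_pr alpha theta i.+1 j.+1 = C i j.
  apply: split_pr_closed; rewrite /C.
  - by rewrite addn0 /=; have h := subalpha_gt0 0; have h1 := subalpha_gt0 1; field; rewrite !gt_eqF.
  - move=> {j} {}i; rewrite !addn0 th.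
    have h := rising_ratio_gt0 i; have a1 := subalpha_gt0 i; have a2 := subalpha_gt0 i.+1.
    have x0 : 0 <= i%:R :> R by [].
    move: h a1 a2 x0; rewrite /= -!natr1; move: (rising_ratio i) (i%:R) => H x h a1 a2 x0.
    field; rewrite !gt_eqF //; lra.
  - move=> {i} {}j; rewrite !add0n th.
    have h := rising_ratio_gt0 j; have a1 := subalpha_gt0 j; have a2 := subalpha_gt0 j.+1.
    have x0 : 0 <= j%:R :> R by [].
    move: h a1 a2 x0; rewrite /= -!natr1; move: (rising_ratio j) (j%:R) => H x h a1 a2 x0.
    field; rewrite !gt_eqF //; lra.
  - move=> {}i {}j; rewrite !addSn !addnS th.
    have hi := rising_ratio_gt0 i; have hj := rising_ratio_gt0 j; have hh := rising_ratio_gt0 (i + j).+2.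
    have a := subalpha_gt0 (i + j).+2.
    have x0 : 0 <= i%:R :> R by []. have y0 : 0 <= j%:R :> R by [].
    move: hi hj hh a x0 y0; rewrite (rising_ratioS (i + j).+2) (rising_ratioS i) (rising_ratioS j) -!natr1 !natrD.
    move: (rising_ratio i) (rising_ratio j) (rising_ratio (i + j).+2) (i%:R) (j%:R) => H K L x y hi hj hh a x0 y0.
    field; rewrite !gt_eqF //; lra.
rewrite !E /C /closed_split [(j + i)%N]addnC.
have hh := rising_ratio_gt0 (i + j).+1; have a := subalpha_gt0 (i + j).+1.
have x0 : 0 <= i%:R :> R by []. have y0 : 0 <= j%:R :> R by [].
move: hh a x0 y0; rewrite -!natr1 !natrD.
move: (rising_ratio _.+1) (rising_ratio i) (rising_ratio j) (i%:R) (j%:R) => L H K x y hh a x0 y0.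
field; rewrite !gt_eqF //; lra.
Qed.


Lemma closed_consistent (q : nat -> nat -> R) :
  (forall i j, q i.+1 j.+1 = closed_split i j) ->
  forall a b, (0 < a)%N -> (0 < b)%N ->
     2 * q 1%N (a + b)%N * q a b + a.+1%:R * q a.+1 b + b.+1%:R * q a b.+1
     = (a + b).+1%:R * q a b.
Proof.
move=> E [//|i] [//|j] _ _; rewrite addSn addnS !E /closed_split !add0n !addSn !addnS.
have hi := rising_ratio_gt0 i; have hj := rising_ratio_gt0 j; have hh := rising_ratio_gt0 (i + j).+1.
have a := subalpha_gt0 (i + j).+1.
have x0 : 0 <= i%:R :> R by []. have y0 : 0 <= j%:R :> R by [].
move: hi hj hh a x0 y0; rewrite (rising_ratioS (i + j).+1) (rising_ratioS i) (rising_ratioS j) [rising_ratio 0]/= -!natr1 !natrD.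
move: (rising_ratio i) (rising_ratio j) (rising_ratio (i + j).+1) (i%:R) (j%:R) => H K L x y hi hj hh a x0 y0.
field; rewrite !gt_eqF //; lra.
Qed.

End ClosedForm.

(** At alpha = 1/2 the quadratic factor of [closed_split] cancels its denominator
    up to 1/4, and the product over the branch points telescopes: the shapes of a
    given size are equally likely, which makes this an inverse Catalan number. *)
Lemma branching_half (R : realType) (t : tree unit) :
  branching (symm (split_pr (1 / 2) (1 / 2 : R))) t
  = (4 ^+ (nleaves t).-1 * rising_ratio (1 / 2) (nleaves t).-1)^-1.
Proof.
have lt1 : 1 / 2 < 1 :> R by lra.
elim: t => [[]|l IHl r IHr]; first by rewrite /= !mulr1 invr1.
rewrite [LHS]/= IHl IHr nleaves_Node.
case: (nleaves l) (nleaves_gt0 l) => [//|i] _; case: (nleaves r) (nleaves_gt0 r) => [//|j] _.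
rewrite symm_split_closed1 //; last by lra.
rewrite addSn addnS [_.-1]/= /closed_split exprS exprD ![_.+1.-1]/=.
have hi := @rising_ratio_gt0 _ _ lt1 i; have hj := @rising_ratio_gt0 _ _ lt1 j.
have hh := @rising_ratio_gt0 _ _ lt1 (i + j).+1.
have x0 : 0 <= i%:R :> R by []. have y0 : 0 <= j%:R :> R by [].
have ei : 0 < 4 ^+ i :> R by rewrite exprn_gt0.
have ej : 0 < 4 ^+ j :> R by rewrite exprn_gt0.
move: hi hj hh ei ej; move: (rising_ratio _ i) (rising_ratio _ j) (rising_ratio _ _.+1) (4 ^+ i) (4 ^+ j).
move=> H K L X Y hi hj hh ei ej; move: x0 y0; rewrite -!natr1 !natrD.
move: (i%:R) (j%:R) => x y x0 y0.
field; rewrite !gt_eqF //; lra.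
Qed.

(** * The law of the labelled tree *)

(** This planar order is preserved by [growths], see [growths_min_left]. *)
Fixpoint min_left (t : tree nat) : bool :=
  if t is Node l r then [&& (minlabel l < minlabel r)%N, min_left l & min_left r] else true.

Definition unlabel : tree nat -> tree unit := tmap (fun=> tt).

Lemma labels_tmap (A B : Type) (f : A -> B) (t : tree A) : labels (tmap f t) = map f (labels t).
Proof. by elim: t => //= l IHl r IHr; rewrite map_cat IHl IHr. Qed.

Lemma nleaves_tmap (A B : Type) (f : A -> B) (t : tree A) : nleaves (tmap f t) = nleaves t.
Proof. by rewrite /nleaves labels_tmap size_map. Qed.

Section TreeLaw.
Variables (R : realType) (alpha theta : R).
Hypothesis theta_ge0 : 0 <= theta.

Let grow := growths alpha theta.

Lemma growths_inserts x t p : p \in grow x t -> p.2 \in inserts x t.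
Proof.
elim: t p => [a|l IHl r IHr] p; rewrite /= !inE.
  by move/eqP->; rewrite eqxx orbT.
case/orP => [/eqP->|]; first by rewrite eqxx orbT.
rewrite !mem_cat => /orP[] /mapP[p' /[dup] hp' hp ->] /=; apply/orP; right; apply/orP; right;
  apply/orP; [left|right].
  by apply/mapP; exists p'.2; rewrite ?(IHl p').
by apply/mapP; exists p'.2; rewrite ?(IHr p').
Qed.


(** The new leaf is put on the right of a subtree whose labels are all smaller.
    The order of the subtrees therefore tells which one has the smallest label, and
    the weights are functions of the planar shape. *)
Lemma growths_min_left x t : min_left t -> all (ltn^~ x) (labels t) ->
  [/\ {in grow x t, forall p, minlabel p.2 = minlabel t /\ min_left p.2},
      [seq (p.1, unlabel p.2) | p <- grow x t] = shape_growths alpha theta (unlabel t)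
    & \sum_(p <- grow x t) p.1 = 1].
Proof.
elim: t => [a|l IHl r IHr] /=.
  rewrite andbT => _ ax; split => //; last by rewrite big_seq1.
  by move=> p; rewrite inE => /eqP-> /=; rewrite ax /minn ax.
case/and3P=> lr ml mr; rewrite all_cat => /andP[al ar].
have [IHl1 IHl2 IHl3] := IHl ml al; have [IHr1 IHr2 IHr3] := IHr mr ar.
rewrite lr /minn lr.
set L := nleaves l; set M := nleaves r.
have -> : alpha + (L%:R - 1 + theta) + (M%:R - alpha) = (L + M)%:R - 1 + theta.
  by rewrite natrD; ring.
split.
- move=> p; rewrite inE => /orP[/eqP->|] /=.
    have := minlabel_in l => /(allP al) /= lx.
    by rewrite /minn lr lx ml mr.
  rewrite mem_cat => /orP[] /mapP[p' hp' ->] /=.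
    by have [-> ->] := IHl1 _ hp'; rewrite /minn lr mr.
  by have [-> ->] := IHr1 _ hp'; rewrite /minn lr ml.
- rewrite /unlabel /= nleaves_Node !nleaves_tmap -/L -/M /root_pr.
  have -> : (L + M == 1)%N = false.
    exact: gtn_eqF (leq_add (nleaves_gt0 l) (nleaves_gt0 r)).
  congr (_ :: _); rewrite map_cat -!map_comp; congr (_ ++ _).
    rewrite -[tmap _ l]/(unlabel l) -[tmap _ r]/(unlabel r) -IHl2 -map_comp.
    by apply: eq_map => p /=.
  rewrite -[tmap _ l]/(unlabel l) -[tmap _ r]/(unlabel r) -IHr2 -map_comp.
  by apply: eq_map => p /=.
- rewrite big_cons big_cat !big_map /= -!mulr_sumr IHl3 IHr3.
  have : 0 < (L + M)%:R - 1 + theta.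
    rewrite /L /M; case: (nleaves l) (nleaves_gt0 l) => // i _.
    case: (nleaves r) (nleaves_gt0 r) => // j _.
    by rewrite addnS -natr1 addrK addSn den_gt0.
  rewrite lr -/L -/M natrD => D0; field; rewrite gt_eqF //; lra.
Qed.

(** The law of the tree with k + 1 leaves, as a list of weighted planar
    representatives with repetitions. *)
Fixpoint tree_law k : seq (R * tree nat) :=
  if k is k'.+1
  then [seq (p.1 * q.1, q.2) | p <- tree_law k', q <- grow k.+1 p.2]
  else [:: (1, Leaf 1%N)].

Lemma sum_tree_lawS k (F : tree nat -> R) :
  \sum_(p <- tree_law k.+1) p.1 * F p.2
  = \sum_(p <- tree_law k) p.1 * \sum_(q <- grow k.+2 p.2) q.1 * F q.2.
Proof.
rewrite /= big_allpairs_dep; apply: eq_bigr => p _; rewrite mulr_sumr.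
by apply: eq_bigr => q _; rewrite mulrA.
Qed.

Lemma tree_law_labels k p : p \in tree_law k ->
  perm_eq (labels p.2) (iota 1 k.+1) /\ min_left p.2.
Proof.
elim: k p => [|k IH] p; first by rewrite inE => /eqP->.
case/allpairsPdep => p' [q [/IH[pl pm] hq ->]]; rewrite [_.2]/=.
have px : all (ltn^~ k.+2) (labels p'.2).
  by rewrite (perm_all _ pl); apply/allP => i; rewrite mem_iota /=; lia.
split; last by have [/(_ _ hq)[]] := growths_min_left pm px.
have /growths_inserts/inserts_labels/permPl-> := hq.
rewrite -(addn1 k.+1) iotaD add1n perm_sym perm_catC /=.
by rewrite addn1 perm_cons perm_sym.
Qed.

Lemma tree_law_lt k p : p \in tree_law k -> all (ltn^~ k.+2) (labels p.2).
Proof.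
case/tree_law_labels => /(perm_all (ltn^~ k.+2))-> _.
by apply/allP => i; rewrite mem_iota /=; lia.
Qed.

Lemma tree_law_uniq k p : p \in tree_law k -> uniq (labels p.2).
Proof. by case/tree_law_labels => /perm_uniq-> _; rewrite iota_uniq. Qed.

Lemma sum_tree_law1 k : \sum_(p <- tree_law k) p.1 = 1.
Proof.
elim: k => [|k IH]; first by rewrite big_seq1.
under eq_bigr do rewrite -[_.1]mulr1.
rewrite (sum_tree_lawS k (fun=> 1)) -[RHS]IH; apply: eq_big_seq => p hp.
have [_ pm] := tree_law_labels hp; have [_ _] := growths_min_left pm (tree_law_lt hp).
by under [in X in _ -> X]eq_bigr do rewrite mulr1; move=> ->; rewrite mulr1.
Qed.

Lemma sum_growths_shape k p (F : tree unit -> R) : p \in tree_law k ->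
  \sum_(q <- grow k.+2 p.2) q.1 * F (unlabel q.2)
  = \sum_(q <- shape_growths alpha theta (unlabel p.2)) q.1 * F q.2.
Proof.
move=> hp; have [_ pm] := tree_law_labels hp.
by have [_ <- _] := growths_min_left pm (tree_law_lt hp); rewrite big_map.
Qed.

Lemma sum_tree_law_shape k (F : tree unit -> R) :
  \sum_(p <- tree_law k) p.1 * F (unlabel p.2)
  = \sum_(t <- shapes k.+1) branching (split_pr alpha theta) t * F t.
Proof.
elim: k F => [|k IH] F; first by rewrite !big_seq1.
rewrite (sum_tree_lawS k (fun t => F (unlabel t))) -sum_branching_growths //.
rewrite -(IH (fun s => \sum_(p <- shape_growths alpha theta s) p.1 * F p.2)).
by apply: eq_big_seq => p hp; rewrite sum_growths_shape.
Qed.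

End TreeLaw.

(** * The uniform case *)

Lemma uniq_map_inj (A B : eqType) (f : A -> B) (s : seq A) :
  uniq (map f s) -> {in s &, injective f}.
Proof.
elim: s => //= a s IH /andP[fa /IH inj] x y; rewrite !inE.
move=> /orP[/eqP->|xs] /orP[/eqP->|ys] // fxy; last exact: inj.
  by case/mapP: fa; exists y.
by case/mapP: fa; exists x.
Qed.

Lemma inserts_tmap (A B : choiceType) (f : A -> B) x t :
  map (tmap f) (inserts x t) = inserts (f x) (tmap f t).
Proof.
elim: t => //= l IHl r IHr; rewrite map_cat -!map_comp -IHl -IHr -!map_comp.
by congr [:: _, _ & _ ++ _]; apply: eq_map.
Qed.

(** An isomorphism matches the edges, hence the insertions. *)
Lemma sum_inserts_iso (V : nmodType) (A : choiceType) x (t u : tree A) (F : tree A -> V) :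
  (forall v v', iso v v' -> F v = F v') -> iso t u ->
  \sum_(v <- inserts x t) F v = \sum_(v <- inserts x u) F v.
Proof.
move=> iF; elim: t u F iF => [a|l IHl r IHr] [b|l' r'] //= F iF; first by move/eqP->.
move=> tu; rewrite !big_cons !big_cat !big_map.
congr (_ + (_ + _)); [by apply: iF; rewrite /= eqxx tu| by apply: iF; rewrite /= eqxx tu|].
case/orP: tu => /andP[il ir].
  congr (_ + _).
    rewrite (IHl l' (fun v => F (Node v r))) //.
      by apply: eq_bigr => v _; apply: iF; rewrite /= iso_refl ir.
    by move=> v v' vv; apply: iF; rewrite /= iso_refl vv.
  rewrite (IHr r' (fun v => F (Node l v))) //.
    by apply: eq_bigr => v _; apply: iF; rewrite /= iso_refl il.
  by move=> v v' vv; apply: iF; rewrite /= iso_refl vv.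
rewrite [RHS]addrC; congr (_ + _).
  rewrite (IHl r' (fun v => F (Node v r))) //.
    by apply: eq_bigr => v _; apply: iF; rewrite /= iso_refl ir orbT.
  by move=> v v' vv; apply: iF; rewrite /= iso_refl vv.
rewrite (IHr l' (fun v => F (Node l v))) //.
  by apply: eq_bigr => v _; apply: iF; rewrite /= iso_refl il orbT.
by move=> v v' vv; apply: iF; rewrite /= iso_refl vv.
Qed.

(** All planar trees with labels 1, ..., k + 1, see [mem_planar_trees]. *)
Fixpoint planar_trees k : seq (tree nat) :=
  if k is k'.+1 then [seq t | s <- planar_trees k', t <- inserts k.+1 s] else [:: Leaf 1%N].

Lemma sum_count_memC (V : eqType) (X Y : seq V) :
  (\sum_(s <- X) count_mem s Y = \sum_(s <- Y) count_mem s X)%N.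
Proof.
under eq_bigr do rewrite -sum1_count big_mkcond; under [RHS]eq_bigr do rewrite -sum1_count big_mkcond.
by rewrite exchange_big; apply: eq_bigr => y _; apply: eq_bigr => x _ /=; rewrite eq_sym.
Qed.

(** By transposition, a planar tree t is produced once for each entry of [cuts]
    at its largest label, and there is one such entry. *)
Lemma count_planar_trees k t : count_mem t (planar_trees k) = perm_eq (labels t) (iota 1 k.+1).
Proof.
elim: k t => [|k IH] t.
  rewrite /= addn0; congr nat_of_bool; apply/eqP/idP => [<- //|].
  case: t => [a /perm_mem/(_ a)|l r /perm_size].
    by rewrite !inE eqxx => /esym/eqP->.
  by move=> /= E; have := nleaves_Node_gt1 l r; rewrite /nleaves /= E.
rewrite /= count_flatten sumnE !big_map.
under eq_bigr do rewrite map_id count_inserts.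
rewrite sum_count_memC; under eq_bigr do rewrite IH.
have iota_k : perm_eq (iota 1 k.+2) (k.+2 :: iota 1 k.+1).
  by rewrite -[in X in perm_eq X _](addn1 k.+1) iotaD add1n perm_catC.
rewrite -[1%N :: _]/(iota 1 k.+2).
case: (boolP (perm_eq (labels t) (iota 1 k.+2))) => tk.
  rewrite (eq_big_seq (fun=> 1%N)).
    rewrite sum1_size size_cuts; last by rewrite /nleaves (perm_size tk) size_iota.
    by rewrite (permP tk) count_uniq_mem ?iota_uniq // mem_iota; lia.
  move=> s /cuts_labels; rewrite (permPl tk) (permPl iota_k) perm_cons.
  by rewrite perm_sym => ->.
rewrite big1_seq // => s /cuts_labels ts; apply/eqP; rewrite eqb0.
by apply: contraNN tk => sk; rewrite (permPl ts) (permPr iota_k) perm_cons.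
Qed.

Lemma mem_planar_trees k t : (t \in planar_trees k) = perm_eq (labels t) (iota 1 k.+1).
Proof. by rewrite -has_pred1 has_count count_planar_trees lt0b. Qed.

Lemma planar_trees_uniq k : uniq (planar_trees k).
Proof. by apply: count_mem_uniq => t; rewrite count_planar_trees mem_planar_trees. Qed.

Lemma tmap_inj_in (s : nat -> nat) (V : seq nat) (t u : tree nat) :
  {in V &, injective s} -> {subset labels t <= V} -> {subset labels u <= V} ->
  tmap s t = tmap s u -> t = u.
Proof.
move=> inj; elim: t u => [a|l IHl r IHr] [b|l' r'] //= tV uV [].
  by move/(inj _ _ (tV _ (mem_head _ _)) (uV _ (mem_head _ _)))->.
move=> /IHl El /IHr Er.
have sub (X : seq nat) (v v' : seq nat) : {subset v ++ v' <= X} -> {subset v <= X} /\ {subset v' <= X}.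
  by move=> h; split => i iv; apply: h; rewrite mem_cat iv ?orbT.
have [tl tr] := sub _ _ _ tV; have [ul ur] := sub _ _ _ uV.
by rewrite (El tl ul) (Er tr ur).
Qed.

(** Relabelling is injective on these trees and preserves their set of labels. *)
Lemma perm_relabel_planar_trees k (s : nat -> nat) :
  perm_eq [seq s i | i <- iota 1 k.+1] (iota 1 k.+1) ->
  perm_eq (map (tmap s) (planar_trees k)) (planar_trees k).
Proof.
move=> ps; have inj : {in iota 1 k.+1 &, injective s}.
  by apply: uniq_map_inj; rewrite (perm_uniq ps) iota_uniq.
have U : uniq (map (tmap s) (planar_trees k)).
  rewrite map_inj_in_uniq ?planar_trees_uniq // => t u.
  rewrite !mem_planar_trees => /perm_mem tk /perm_mem uk.
  by apply: (tmap_inj_in inj) => i; rewrite (tk, uk).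
have S : {subset map (tmap s) (planar_trees k) <= planar_trees k}.
  move=> _ /mapP[t + ->]; rewrite !mem_planar_trees labels_tmap => tk.
  exact: perm_trans (perm_map s tk) ps.
have [|_ E] := uniq_min_size U S; first by rewrite size_map.
by apply: uniq_perm; rewrite ?planar_trees_uniq.
Qed.

Section Half.
Variables (R : realType).
Notation grow := (growths (1 / 2 : R) (1 / 2)).

(** At alpha = theta = 1/2 the weight of a subtree is half of its number of
    edges, 2 n - 1 for n leaves, so the selected edge is uniform. Insertions on the
    two sides of an edge give isomorphic trees, whence the additional factor 2. *)
Lemma sum_growths_half x t (F : tree nat -> R) :
  (forall v v', iso v v' -> F v = F v') ->
  \sum_(q <- grow x t) q.1 * F q.2
  = (2 * (2 * (nleaves t)%:R - 1))^-1 * \sum_(v <- inserts x t) F v.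
Proof.
elim: t F => [a|l IHl r IHr] F iF.
  rewrite /= !big_cons !big_nil /= (iF _ _ (iso_swap (Leaf x) (Leaf a))).
  by rewrite (_ : nleaves (Leaf a) = 1%N) //; field.
have scale (c : R) (D : seq (R * tree nat)) (G : R * tree nat -> R) :
    \sum_(p <- D) c * p.1 * G p = c * \sum_(p <- D) p.1 * G p.
  by rewrite mulr_sumr; apply: eq_bigr => p _; rewrite mulrA.
rewrite [inserts _ _]/= [growths _ _ _ _]/= !big_cons !big_cat !big_map /=.
rewrite (iF _ _ (iso_swap (Leaf x) (Node l r))).
rewrite !scale nleaves_Node natrD.
rewrite (IHl (fun v => F (Node v r))); last by move=> v v' vv; apply: iF; rewrite /= iso_refl vv.
rewrite (IHr (fun v => F (Node l v))); last by move=> v v' vv; apply: iF; rewrite /= iso_refl vv.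
move: (\sum_(v <- inserts x l) _) (\sum_(v <- inserts x r) _) => SL SR.
have : 1 <= (nleaves l)%:R :> R by rewrite ler1n nleaves_gt0.
have : 1 <= (nleaves r)%:R :> R by rewrite ler1n nleaves_gt0.
move: (nleaves l)%:R (nleaves r)%:R (F _) => L M X M1 L1.
by case: ifP => _; field; rewrite !gt_eqF //; lra.
Qed.

Fixpoint half_coef k : R := if k is j.+1 then half_coef j / (2 * (2 * k%:R - 1)) else 1.

Lemma sum_tree_law_half k (F : tree nat -> R) :
  (forall v v', iso v v' -> F v = F v') ->
  \sum_(p <- tree_law (1 / 2) (1 / 2) k) p.1 * F p.2
  = half_coef k * \sum_(t <- planar_trees k) F t.
Proof.
have h0 : 0 <= 1 / 2 :> R by lra.
elim: k F => [|k IH] F iF; first by rewrite !big_seq1.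
rewrite sum_tree_lawS [planar_trees _]/= big_allpairs_dep /= mulrAC.
rewrite -(IH (fun s => \sum_(t <- inserts k.+2 s) F t)) ?mulr_suml; last first.
  by move=> v v' vv; apply: sum_inserts_iso.
apply: eq_big_seq => p /(tree_law_labels h0)[/perm_size np _].
by rewrite sum_growths_half // /nleaves np size_iota; ring.
Qed.

Lemma sum_tree_law_relabel k (s : nat -> nat) (F : tree nat -> R) :
  perm_eq [seq s i | i <- iota 1 k.+1] (iota 1 k.+1) ->
  (forall v v', iso v v' -> F v = F v') ->
  \sum_(p <- tree_law (1 / 2) (1 / 2) k) p.1 * F (tmap s p.2)
  = \sum_(p <- tree_law (1 / 2) (1 / 2) k) p.1 * F p.2.
Proof.
move=> ps iF; rewrite sum_tree_law_half // (sum_tree_law_half k (F := F \o tmap s)).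
  by congr (_ * _); rewrite -[RHS](perm_big _ (perm_relabel_planar_trees ps)) big_map.
by move=> v v' vv /=; apply/iF/iso_tmap.
Qed.

End Half.

(** * From the random process to weighted lists *)

Section Process.
Local Open Scope quotient_scope.
Local Open Scope classical_set_scope.
Local Open Scope quotient_scope.
Context (R : realType) (d : measure_display) (Omega : measurableType d).
Context (P : probability Omega R).

Lemma measurable_ltree (X : {RV P >-> ltree}) (C : set ltree) :
  measurable [set w | C (X w)].
Proof. by have /(_ I) := @measurable_funPTI _ _ _ _ X C. Qed.

Lemma measure_values (X : {RV P >-> ltree}) (V : seq ltree) (E : set Omega) :
  uniq V -> measurable E ->
  P (E `&` [set w | X w \in V]) = (\sum_(v <- V) P (E `&` [set w | X w = v]))%E.
Proof.
move=> + mE; elim: V => [|v V IH] /=.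
  by move=> _; rewrite big_nil (_ : _ `&` _ = set0) ?measure0 //; apply/seteqP; split => w // [].
case/andP=> vV uV; rewrite big_cons -IH // -measureU //.
- congr (P _); apply/seteqP; split => w /=.
    by case=> Ew; rewrite inE => /orP[/eqP|]; [left|right].
  by case=> -[Ew h]; split => //; rewrite inE h ?eqxx ?orbT.
- by apply: measurableI => //; exact: (measurable_ltree X [set v]).
- by apply: measurableI => //; exact: (measurable_ltree X [set x | x \in V]).
- by apply/seteqP; split => w // -[[_ /= ->] [_]]; rewrite /= (negPf vV).
Qed.

Lemma measure_setI_sure (A E : set Omega) : measurable A -> measurable E ->
  P A = 1%E -> P (E `&` A) = P E.
Proof.
move=> mA mE PA.
rewrite [RHS](measureDI P mE mA) [X in (X + _)%E](_ : _ = 0%E) ?add0e //.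
apply/eqP; rewrite eq_le measure_ge0 andbT.
have -> : 0%E = P (~` A) by rewrite probability_setC // PA subee.
by apply: le_measure; rewrite ?inE; [exact: measurableD|exact: measurableC|move=> w []].
Qed.

Lemma total_values (X : {RV P >-> ltree}) (V : seq ltree) (E : set Omega) :
  uniq V -> P [set w | X w \in V] = 1%E -> measurable E ->
  P E = (\sum_(v <- V) P (E `&` [set w | X w = v]))%E.
Proof.
move=> uV PV mE; rewrite -measure_values // measure_setI_sure //.
exact: (measurable_ltree X [set x | x \in V]).
Qed.

Variables (alpha theta : R) (T : nat -> {RV P >-> ltree}).
Hypotheses (theta_ge0 : 0 <= theta) (proc : growth_process alpha theta T).

Notation law := (tree_law alpha theta).
Notation grow := (growths alpha theta).

Definition point_law k : Prop := forall u : ltree,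
  P [set w | T k.+1 w = u] = (\sum_(p <- law k) p.1 * (\pi_(ltree) p.2 == u)%:R)%:E.

Definition values k : seq ltree := undup [seq \pi_(ltree) p.2 | p <- law k].

Lemma mem_values k p : p \in law k -> \pi_(ltree) p.2 \in values k.
Proof. by move=> hp; rewrite mem_undup map_f. Qed.

Lemma values_uniq k : uniq (values k). Proof. exact: undup_uniq. Qed.

Lemma sum_law_by_value k (F : ltree -> R) :
  \sum_(v <- values k) (\sum_(p <- law k) p.1 * (\pi_(ltree) p.2 == v)%:R) * F v
  = \sum_(p <- law k) p.1 * F (\pi_(ltree) p.2).
Proof.
have := sum_by_value (D := [seq (p.1, \pi_(ltree) p.2) | p <- law k]) F (values_uniq k).
rewrite big_map => ->; last by move=> _ /mapP[p hp ->]; apply: mem_values.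
apply: eq_bigr => v _; rewrite big_map /= [in RHS]big_mkcond; congr (_ * _).
by apply: eq_bigr => p _; case: eqP; rewrite (mulr1, mulr0).
Qed.

Lemma point_law_values k : point_law k -> P [set w | T k.+1 w \in values k] = 1%E.
Proof.
move=> Lk; rewrite -[[set _ | _]]setTI measure_values ?values_uniq //.
under eq_bigr do rewrite setTI Lk.
rewrite sumEFin; congr EFin.
have := sum_law_by_value k (fun=> 1).
under eq_bigr do rewrite mulr1; under [in RHS]eq_bigr do rewrite mulr1.
by move=> ->; rewrite sum_tree_law1.
Qed.

Lemma measurable_history (t : nat -> ltree) k n : (k <= n)%N ->
  measurable [set w | forall j, (k <= j <= n)%N -> T j w = t j].
Proof.
move=> kn; rewrite (_ : [set _ | _] =
   \bigcap_(j in [set j | (k <= j <= n)%N]) [set w | T j w = t j]) //.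
apply: bigcap_measurable; first by exists k; rewrite /= leqnn.
by move=> j _; exact: (measurable_ltree (T j) [set t j]).
Qed.

(** The hypothesis on the process conditions on all past trees. The condition on
    those before the k-th one is removed by summing over the finitely many values of
    each. *)
Lemma markov_history n (t : nat -> ltree) u k : (2 <= n)%N -> (1 <= k <= n)%N ->
  (forall i, (i < n)%N -> point_law i) ->
  P [set w | (forall j, (k <= j <= n)%N -> T j w = t j) /\ T n.+1 w = u]
  = (P [set w | forall j, (k <= j <= n)%N -> T j w = t j]
     * (growth_prob alpha theta n (t n) u)%:E)%E.
Proof.
move=> n2 + L; case: proc => _ _ H.
elim: k t => [//|k IH] t /= kn.
case: k IH kn => [|k] IH kn; first exact: H.
(* a value v of the tree that precedes a history extends it by one step *)
pose upd v := fun j => if j == k.+1 then v else t j.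
have eq_upd v : [set w | forall j, (k.+2 <= j <= n)%N -> T j w = t j] `&` [set w | T k.+1 w = v]
    = [set w | forall j, (k.+1 <= j <= n)%N -> T j w = upd v j].
  apply/seteqP; split => w /=.
    move=> [h hk] j; rewrite /upd; case: eqP => [->//|jk jn]; apply: h; lia.
  move=> h; split; last by rewrite (h k.+1) /upd ?eqxx //; lia.
  by move=> j jn; rewrite h /upd; [case: eqP => // E|]; lia.
have mu : measurable [set w | T n.+1 w = u] by exact: (measurable_ltree (T n.+1) [set u]).
have PV := point_law_values (L k ltac:(lia)).
rewrite (total_values (values_uniq k) PV (measurable_history t kn)).
rewrite (total_values (values_uniq k) PV); last exact: measurableI (measurable_history t kn) mu.
rewrite ge0_sume_distrl; last by move=> v _; exact: measure_ge0.
apply: eq_bigr => v _; rewrite eq_upd.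
have -> : growth_prob alpha theta n (t n) u = growth_prob alpha theta n (upd v n) u.
  by rewrite /upd; case: eqP => // E; lia.
rewrite -IH; last by lia.
congr (P _); rewrite -[[set w | _ /\ _]]/([set w | _] `&` [set w | _]) setIAC.
by rewrite eq_upd.
Qed.

Lemma growth_prob_law k p u : p \in law k ->
  growth_prob alpha theta k.+1 (\pi_(ltree) p.2) u
  = \sum_(q <- grow k.+2 p.2) q.1 * (\pi_(ltree) q.2 == u)%:R.
Proof.
move=> hp; rewrite growth_prob_pi ?(tree_law_uniq theta_ge0 hp) // big_mkcond.
by apply: eq_bigr => q _; case: eqP; rewrite (mulr1, mulr0).
Qed.

Lemma point_law0 : point_law 0.
Proof.
move=> u; case: proc => P1 _ _; rewrite big_seq1 mul1r.
case: eqP => [<- //|ne].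
rewrite -(measure_setI_sure (A := [set w | T 1%N w = npleaf 1%N])) //.
- rewrite (_ : _ `&` _ = set0) ?measure0 //; apply/seteqP; split => w //= [h1 h].
  by apply: ne; rewrite -h1 h.
- exact: (measurable_ltree (T 1%N) [set npleaf 1%N]).
- exact: (measurable_ltree (T 1%N) [set u]).
Qed.

(** With one leaf, both trees are constant, and the only growth step is the
    attachment of the second leaf. *)
Lemma markov_step k v u : (forall i, (i <= k)%N -> point_law i) ->
  P [set w | T k.+1 w = v /\ T k.+2 w = u]
  = (P [set w | T k.+1 w = v] * (growth_prob alpha theta k.+1 v u)%:E)%E.
Proof.
case: k => [|k] L.
  case: proc => P1 P2 _.
  have m1 v' : measurable [set w | T 1%N w = v'] by exact: (measurable_ltree (T 1%N) [set v']).
  have m2 v' : measurable [set w | T 2%N w = v'] by exact: (measurable_ltree (T 2%N) [set v']).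
  rewrite -[[set w | _ /\ _]]/([set w | T 1%N w = v] `&` [set w | T 2%N w = u]).
  rewrite -(measure_setI_sure (m2 _) _ P2); last exact: measurableI.
  have gp := growth_prob_law (k := 0) (p := (1, Leaf 1%N)) u (mem_head _ _).
  rewrite point_law0 big_seq1 mul1r; case: eqP => [<-|ne]; last first.
    rewrite mul0e -(measure_setI_sure (m1 _) _ P1); last by do 2?apply: measurableI.
    rewrite (_ : _ `&` _ = set0) ?measure0 //.
    by apply/seteqP; split => w //= [[[h1 _] _] h2]; apply: ne; rewrite -h1 h2.
  rewrite mul1e [growth_prob _ _ _ _ _]gp big_seq1 mul1r.
  rewrite -[[set w | T 1%N w = _]]/([set w | T 1%N w = npleaf 1%N]).
  case: eqP => /= [<-|ne].
    rewrite -setIA setIid setIC measure_setI_sure //; exact: P2.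
  rewrite (_ : _ `&` _ = set0) ?measure0 //.
  by apply/seteqP; split => w //= [[_ h1] h2]; apply: ne; rewrite -h1 h2.
have := @markov_history k.+2 (fun=> v) u k.+2 isT.
have -> : [set w | forall j, (k.+2 <= j <= k.+2)%N -> T j w = v] = [set w | T k.+2 w = v].
  apply/seteqP; split => w /=; first by apply; rewrite leqnn.
  by move=> h j /andP[h1 h2]; rewrite (_ : j = k.+2) //; lia.
move=> <-; rewrite ?leqnn //.
congr (P _); apply/seteqP; split => w /= [h1 h2]; split => //.
  by move=> j /andP[h3 h4]; rewrite (_ : j = k.+2) //; lia.
by apply: h1; rewrite leqnn.
Qed.

Lemma point_lawP k : point_law k.
Proof.
elim/ltn_ind: k => -[|k] IH; first exact: point_law0.
move=> u; have L : forall i, (i <= k)%N -> point_law i by move=> i ik; apply: IH.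
have mu : measurable [set w | T k.+2 w = u] by exact: (measurable_ltree (T k.+2) [set u]).
rewrite (total_values (values_uniq k) (point_law_values (L k _)) mu) //.
under eq_bigr => v _ do
  rewrite setIC -[_ `&` _]/([set w | T k.+1 w = v /\ T k.+2 w = u]) markov_step // L // -EFinM.
rewrite sumEFin sum_law_by_value; congr EFin.
rewrite (sum_tree_lawS _ _ k (fun t => (\pi_(ltree) t == u)%:R)).
by apply: eq_big_seq => p hp; rewrite growth_prob_law.
Qed.

Lemma law_event k (A : pred ltree) :
  P [set w | A (T k.+1 w)] = (\sum_(p <- law k) p.1 * (A (\pi_(ltree) p.2))%:R)%:E.
Proof.
have mA := measurable_ltree (T k.+1) [set x | A x].
rewrite (total_values (values_uniq k) (point_law_values (point_lawP k)) mA).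
rewrite -(sum_law_by_value k (fun v => (A v)%:R)) -sumEFin; apply: eq_bigr => v _.
case: (boolP (A v)) => Av; rewrite (mulr1, mulr0) /=.
  rewrite -point_lawP; congr (P _); apply/seteqP; split => w /=; first by case.
  by move=> E; rewrite E.
rewrite (_ : _ `&` _ = set0) ?measure0 //; apply/seteqP; split => w //= [+ E].
by rewrite /= E (negPf Av).
Qed.

Lemma joint_law_event k (A B : pred ltree) :
  P [set w | A (T k.+1 w) /\ B (T k.+2 w)]
  = (\sum_(p <- law k) p.1 * ((A (\pi_(ltree) p.2))%:R *
       \sum_(q <- grow k.+2 p.2) q.1 * (B (\pi_(ltree) q.2))%:R))%:E.
Proof.
have mA := measurable_ltree (T k.+1) [set x | A x].
have mB := measurable_ltree (T k.+2) [set x | B x].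
have mv v : measurable [set w | T k.+1 w = v] by exact: (measurable_ltree (T k.+1) [set v]).
pose G v := \sum_(u <- values k.+1) growth_prob alpha theta k.+1 v u * (B u)%:R.
transitivity (\sum_(p <- law k) p.1 * ((A (\pi_(ltree) p.2))%:R * G (\pi_(ltree) p.2)))%:E.
  rewrite -[[set w | _ /\ _]]/([set w | A (T k.+1 w)] `&` [set w | B (T k.+2 w)]).
  rewrite (total_values (values_uniq k) (point_law_values (point_lawP k)) (measurableI _ _ mA mB)).
  rewrite -(sum_law_by_value k (fun v => (A v)%:R * G v)) -sumEFin; apply: eq_bigr => v _.
  case: (boolP (A v)) => Av; last first.
    rewrite mul0r mulr0 (_ : _ `&` _ = set0) ?measure0 //; apply/seteqP; split => w //= [[+ _] E].
    by rewrite /= E (negPf Av).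
  rewrite mul1r EFinM -point_lawP /G.
  rewrite (_ : _ `&` _ = [set w | B (T k.+2 w)] `&` [set w | T k.+1 w = v]); last first.
    apply/seteqP; split => w /=; first by case=> -[].
    by case=> h1 h2; rewrite h2.
  rewrite (total_values (values_uniq k.+1) (point_law_values (point_lawP k.+1))); last first.
    exact: measurableI.
  have fv : P [set w | T k.+1 w = v] \is a fin_num by exact: fin_num_measure.
  rewrite -(fineK fv) -EFinM mulr_sumr -sumEFin; apply: eq_bigr => u _.
  rewrite mulrA EFinM EFinM fineK // -markov_step; last by move=> i _; exact: point_lawP.
  case: (boolP (B u)) => Bu; rewrite (mule1, mule0).
    by congr (P _); apply/seteqP; split => w /=; [case=> -[] | case=> h1 h2; rewrite h2].
  rewrite (_ : _ `&` _ = set0) ?measure0 //; apply/seteqP; split => w //= [[+ _] E].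
  by rewrite /= E (negPf Bu).
congr EFin; apply: eq_big_seq => p hp; congr (_ * (_ * _)); rewrite /G.
under eq_bigr => u _ do rewrite (growth_prob_law u hp).
have := sum_by_value (D := [seq (q.1, \pi_(ltree) q.2) | q <- grow k.+2 p.2])
   (fun u => (B u)%:R) (values_uniq k.+1).
rewrite big_map => ->.
  apply: eq_bigr => v _; rewrite big_map /= [in RHS]big_mkcond; congr (_ * _).
  by apply: eq_bigr => q _; case: eqP; rewrite (mulr1, mulr0).
move=> _ /mapP[q hq ->] /=.
apply: (@mem_values k.+1 (p.1 * q.1, q.2)).
by apply/allpairsPdep; exists p, q.
Qed.

End Process.

(** * Sampling consistency *)

Section Positivity.
Variables (R : realType) (alpha theta : R).
Hypotheses (alpha01 : 0 < alpha < 1) (theta_ge0 : 0 <= theta).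

(** Every size has positive probability since 0 < alpha < 1; this allows the class
    probabilities to be cancelled in [strongly_consistent_graft]. *)
Lemma split_law_gt0 n j : (j <= n)%N -> 0 < split_law alpha theta n j.
Proof.
have /andP[a0 a1] := alpha01.
have split0 m i : (forall i', (i' <= m)%N -> 0 < split_law alpha theta m i') -> 0 <= split_law alpha theta m i.
  by move=> h; case: (leqP i m) => [/h/ltW //|/split_law_out ->].
elim: n j => [|n IH] [|j] //= le; apply: divr_gt0; rewrite ?den_gt0 //.
  by rewrite addr0 ltr_pwDl // mulr_ge0 ?split0 // addr_ge0.
rewrite add0r ltr_wpDl ?mulr_ge0 ?split0 ?addr_ge0 //.
by rewrite mulr_gt0 ?IH ?subalpha_gt0.
Qed.

Lemma symm_split_gt0 a b : (0 < a)%N -> (0 < b)%N -> 0 < symm (split_pr alpha theta) a b.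
Proof.
move=> a0 b0; rewrite divr_gt0 // addr_gt0 // split_law_gt0 //; lia.
Qed.

Lemma branching_gt0 t : 0 < branching (symm (split_pr alpha theta)) t.
Proof.
elim: t => //= l IHl r IHr; apply: mulr_gt0; last exact: mulr_gt0.
by rewrite symm_split_gt0 ?nleaves_gt0.
Qed.

Lemma symm_split11 : symm (split_pr alpha theta) 1%N 1%N = 1.
Proof. by rewrite /symm /split_pr /=; field. Qed.

Lemma symm_split12 : symm (split_pr alpha theta) 1%N 2%N = 1 / 2.
Proof.
have := den_gt0 theta_ge0 0; rewrite /symm /split_pr /= /subn /= => D.
by field; rewrite gt_eqF.
Qed.

End Positivity.

Section Shapes.
Local Open Scope quotient_scope.
Context (R : realType) (d : measure_display) (Omega : measurableType d).
Context (P : probability Omega R) (alpha theta : R) (T : nat -> {RV P >-> ltree}).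
Hypotheses (alpha01 : 0 < alpha < 1) (theta_ge0 : 0 <= theta).
Hypothesis proc : growth_process alpha theta T.

Let S n w := delabel (T n w).
Notation f := (branching (symm (split_pr alpha theta))).
Notation law := (tree_law alpha theta).
(** The indicator of an isomorphism class, real-valued so that events become
    factors of sums. *)
Definition in_class (s : utree) (t : tree unit) : R := (\pi_(utree) t == s)%:R.

Lemma in_class_iso s t u : iso t u -> in_class s t = in_class s u.
Proof. by rewrite /in_class -pi_iso => /eqP->. Qed.

Lemma delabel_pi t : delabel (\pi_(ltree) t) = \pi_(utree) (unlabel t).
Proof. exact: relabel_pi. Qed.

Lemma shape_law k s :
  P [set w | S k.+1 w = s]%classic = (\sum_(t <- shapes k.+1) f t * in_class s t)%:E.
Proof.
rewrite (_ : [set w | _]%classic = [set w | delabel (T k.+1 w) == s]%classic); last first.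
  by apply/seteqP; split => w /= /eqP.
rewrite (law_event theta_ge0 proc k (fun v => delabel v == s)); congr EFin.
rewrite -sum_branching_sym; last by move=> *; apply: in_class_iso.
rewrite -sum_tree_law_shape //; apply: eq_bigr => p _.
by rewrite delabel_pi.
Qed.

Lemma shape_joint_law k s t :
  P [set w | S k.+1 w = s /\ S k.+2 w = t]%classic
  = (\sum_(p <- law k) p.1 * (in_class s (unlabel p.2) *
      \sum_(q <- growths alpha theta k.+2 p.2) q.1 * in_class t (unlabel q.2)))%:E.
Proof.
rewrite (_ : [set w | _]%classic =
  [set w | delabel (T k.+1 w) == s /\ delabel (T k.+2 w) == t]%classic); last first.
  by apply/seteqP; split => w /= [/eqP h1 /eqP h2].
rewrite (joint_law_event theta_ge0 proc k (fun v => delabel v == s) (fun v => delabel v == t)).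
congr EFin; apply: eq_bigr => p _; rewrite delabel_pi; congr (_ * (_ * _)).
by apply: eq_bigr => q _; rewrite delabel_pi.
Qed.

Lemma pruning_prob_sum t s :
  pruning_prob R (\pi_(utree) t) s = (\sum_(v <- prunings t) in_class s v) / (nleaves t)%:R.
Proof.
rewrite pruning_prob_pi; congr (_ / _).
rewrite -sum1_count natr_sum big_mkcond; apply: eq_bigr => v _.
by rewrite /in_class; case: eqP.
Qed.

Lemma pruned_joint_lawE k s t :
  pruned_joint_law P S k.+1 s t
  = (\sum_(u <- shapes k.+2) f u * in_class t u
       * (\sum_(v <- prunings u) in_class s v) / k.+2%:R)%:E.
Proof.
rewrite /pruned_joint_law shape_law -EFinM mulr_suml; congr EFin.
apply: eq_big_seq => u; rewrite mem_shapes => /eqP nu.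
rewrite {1 2}/in_class; case: eqP => [<-|_]; last by rewrite mulr0 !mul0r.
by rewrite !mulr1 pruning_prob_sum nu mulrA.
Qed.

Lemma in_class_ge0 s t : 0 <= in_class s t. Proof. by rewrite /in_class. Qed.

Lemma pruned_lawE k s :
  pruned_law P S k.+1 s
  = ((\sum_(t <- shapes k.+1) in_class s t * \sum_(u <- inserts tt t) f u) / k.+2%:R)%:E.
Proof.
pose a u := (f u * (\sum_(v <- prunings u) in_class s v) / k.+2%:R).
have a0 u : 0 <= a u.
  by rewrite /a !mulr_ge0 ?invr_ge0 ?sumr_ge0 // => *; rewrite ?in_class_ge0 ?ltW ?branching_gt0.
rewrite /pruned_law.
transitivity (\esum_(t in [set: utree]) \sum_(u <- shapes k.+2) (a u * in_class t u)%:E)%E.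
  apply: eq_esum => t _; rewrite pruned_joint_lawE sumEFin; congr EFin.
  by apply: eq_bigr => u _; rewrite /a; ring.
rewrite esum_sum; last by move=> t u _ _; rewrite lee_fin mulr_ge0 ?in_class_ge0.
transitivity (\sum_(u <- shapes k.+2) (a u)%:E)%E.
  apply: eq_bigr => u _; rewrite -[RHS](@esum_set1 R _ (\pi_(utree) u) (fun=> (a u)%:E)) //; last first.
    by rewrite lee_fin.
  rewrite [RHS]esum_mkcond; apply: eq_esum => t _.
  rewrite /in_class; case: eqP => [<-|ne]; first by rewrite mem_set // mulr1.
  by rewrite memNset ?mulr0 // => /= h; apply: ne; rewrite h.
rewrite sumEFin; congr EFin; rewrite /a -mulr_suml; congr (_ / _).
under eq_bigr do rewrite mulr_sumr.
rewrite (sum_prunings k.+1 (fun v u => f u * in_class s v)); apply: eq_bigr => v _.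
by rewrite mulr_sumr; apply: eq_bigr => u _; rewrite mulrC.
Qed.

Lemma weakly_consistent_if :
  theta = 1 - alpha \/ theta = 2 - alpha ->
  weakly_sampling_consistent P S.
Proof.
have /andP[a0 a1] := alpha01.
move=> th [//|k] _ s; rewrite pruned_lawE shape_law; congr EFin.
have closed_split : forall i j, symm (split_pr alpha theta) i.+1 j.+1 = closed_split alpha i j.
  by case: th => th; [exact: symm_split_closed1|exact: symm_split_closed2].
rewrite mulr_suml; apply: eq_big_seq => t; rewrite mem_shapes => /eqP nt.
rewrite sum_inserts_branching ?symm_split11 //; last exact: closed_consistent closed_split.
  by rewrite nt; field.
exact: symmC.
Qed.

Definition cherry := Node (Leaf tt) (Leaf tt).
Definition balanced4 := Node cherry cherry.

(** The balanced shape with four leaves is alone in its class, so consistency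
    there is one equation between the splitting probabilities of trees with at most
    five leaves. *)
Lemma weakly_consistent_only_if :
  weakly_sampling_consistent P S ->
  theta = 1 - alpha \/ theta = 2 - alpha.
Proof.
have /andP[a0 a1] := alpha01.
move=> /(_ 4%N isT (\pi_(utree) balanced4)); rewrite pruned_lawE shape_law => -[].
have only (F : tree unit -> R) : \sum_(t <- shapes 4) F t * in_class (\pi_(utree) balanced4) t = F balanced4.
  rewrite (bigD1_seq balanced4) ?shapes_uniq ?mem_shapes //= /in_class eqxx mulr1 big1 ?addr0 // => t.
  rewrite pi_iso; case: (boolP (iso t balanced4)) => [+ /negP[]|_ _]; last by rewrite mulr0.
  by case: t => [//|[//|[[]|? ?] [[]|? ?]] [//|[[]|? ?] [[]|? ?]]] /=; rewrite ?andbF ?orbF.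
rewrite only; under eq_bigr do rewrite mulrC; rewrite only.
rewrite /= !big_cons big_nil /=.
rewrite /nleaves /=.
rewrite (symmC _ 4 1) (symmC _ 3 2) (symmC _ 2 1) symm_split11 symm_split12 //.
set q14 := symm _ 1 4; set q22 := symm _ 2 2; set q23 := symm _ 2 3 => E.
have {}E : 6 * q23 + 2 * q14 * q22 - 5 * q22 = 0.
  by move/eqP: E; rewrite -subr_eq0 => /eqP E; rewrite -[RHS](mulr0 (-5)) -E; field.
have t1 : 1 + theta != 0 by apply: lt0r_neq0; rewrite ltr_wpDr.
have t2 : 2 + theta != 0 by apply: lt0r_neq0; rewrite ltr_wpDr.
have t3 : 3 + theta != 0 by apply: lt0r_neq0; rewrite ltr_wpDr.
(* theta ^+ 2 + 3 * theta + alpha * (3 - alpha) is the positive cofactor *)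
have factor : 6 * q23 + 2 * q14 * q22 - 5 * q22
    = (1 - alpha) * (theta - (1 - alpha)) * (theta - (2 - alpha))
      * (theta ^+ 2 + 3 * theta + alpha * (3 - alpha))
      / ((1 + theta) ^+ 2 * (2 + theta) ^+ 2 * (3 + theta)).
  by rewrite /q14 /q22 /q23 /symm /split_pr /= /subn /=; field; rewrite t1 t2 t3.
have D0 : ((1 + theta) ^+ 2 * (2 + theta) ^+ 2 * (3 + theta))^-1 != 0.
  by rewrite invr_neq0 // !mulf_neq0 ?expf_neq0.
move: E; rewrite factor => /eqP; rewrite mulf_eq0 (negPf D0) orbF !mulf_eq0 !subr_eq0 => /orP[/orP[/orP[|]|]|].
- by move/eqP; lra.
- by move/eqP; left.
- by move/eqP; right.
- by rewrite gt_eqF // ltr_wpDl ?mulr_gt0 ?addr_ge0 ?exprn_ge0 ?mulr_ge0 //; lra.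
Qed.

Lemma strongly_consistent_if :
  alpha = 1 / 2 -> theta = 1 / 2 ->
  strongly_sampling_consistent P S.
Proof.
move=> al th [//|k] _ s t; rewrite pruned_joint_lawE shape_joint_law; congr EFin.
have iF (F : utree -> R) v v' : iso v v' -> F (\pi_(utree) (unlabel v)) = F (\pi_(utree) (unlabel v')).
  by move=> /(iso_tmap (fun=> tt)); rewrite -pi_iso => /eqP; rewrite /unlabel => ->.
pose c : R := (2 * (2 * k.+1%:R - 1))^-1.
transitivity (\sum_(p <- law k) p.1 * (c * (in_class s (unlabel p.2)
    * \sum_(v <- inserts tt (unlabel p.2)) in_class t v))).
  apply: eq_big_seq => p /(tree_law_labels theta_ge0)[/perm_size np _].
  rewrite al th (sum_growths_half k.+2 p.2 (F := fun v => in_class t (unlabel v))); last first.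
    by move=> v v' vv; exact: (iF (fun u => (u == t)%:R)).
  have <- : [seq unlabel v | v <- inserts k.+2 p.2] = inserts tt (unlabel p.2).
    exact: (inserts_tmap (fun=> tt)).
  rewrite /nleaves np size_iota big_map /c.
  by congr (_ * _); rewrite mulrCA.
rewrite (sum_tree_law_shape _ theta_ge0 k
  (fun u => c * (in_class s u * \sum_(v <- inserts tt u) in_class t v))).
rewrite sum_branching_sym; last first.
  move=> u u' uu; rewrite (in_class_iso s uu); congr (_ * (_ * _)).
  by apply: sum_inserts_iso => // v v'; exact: in_class_iso.
transitivity ((4 ^+ k.+1 * rising_ratio (1 / 2) k.+1)^-1 / k.+2%:R *
   \sum_(u <- shapes k.+2) \sum_(v <- prunings u) in_class t u * in_class s v).
  rewrite (sum_prunings k.+1 (fun v u => in_class t u * in_class s v)) mulr_sumr.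
  apply: eq_big_seq => v; rewrite mem_shapes => /eqP nv.
  rewrite al th branching_half nv -mulr_suml.
  have lt1 : 1 / 2 < 1 :> R by lra.
  have h := rising_ratio_gt0 lt1 k; have e : 0 < 4 ^+ k :> R by rewrite exprn_gt0.
  rewrite exprS rising_ratioS /c [k.+1.-1]/=; move: h e; move: (rising_ratio _ k) (4 ^+ k) => H X h e.
  have k0 : 0 <= k%:R :> R by [].
  move: k0; rewrite -!natr1; move: (k%:R) => x x0.
  by field; rewrite !gt_eqF //; lra.
rewrite mulr_sumr; apply: eq_big_seq => u; rewrite mem_shapes => /eqP nu.
by rewrite al th branching_half nu -mulr_sumr [k.+2.-1]/=; ring.
Qed.


Lemma iso_Node1 l r s : (1 < nleaves s)%N ->
  iso (Node l r) (Node s (Leaf tt))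
  = (r == Leaf tt) && iso l s || (l == Leaf tt) && iso r s.
Proof.
have isoL (t : tree unit) : iso t (Leaf tt) = (t == Leaf tt).
  by case: t => [[]|? ?] //=; rewrite !eqxx.
by move=> s1 /=; rewrite !isoL andbC; congr (_ || _).
Qed.

(** The planar shapes isomorphic to a branch point with subtrees s and a leaf are
    the shapes of the class of s with a leaf on the right or on the left. *)
Lemma sum_class_graft n (s : tree unit) : nleaves s = n -> (1 < n)%N ->
  \sum_(t <- shapes n.+1) f t * in_class (\pi_(utree) (Node s (Leaf tt))) t
  = 2 * symm (split_pr alpha theta) n 1%N
    * \sum_(t <- shapes n) f t * in_class (\pi_(utree) s) t.
Proof.
move=> ns n1; set c := Node s (Leaf tt).
pose D := [seq Node t (Leaf tt) | t <- shapes n] ++ [seq Node (Leaf tt) t | t <- shapes n].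
have incD t : t \in shapes n ->
    in_class (\pi_(utree) c) (Node t (Leaf tt)) = in_class (\pi_(utree) s) t
    /\ in_class (\pi_(utree) c) (Node (Leaf tt) t) = in_class (\pi_(utree) s) t.
  rewrite mem_shapes => /eqP nt; rewrite /in_class !pi_iso !iso_Node1 ?ns // eqxx /=.
  by rewrite eqLeaf nt gtn_eqF //= orbF.
have condE (L : seq (tree unit)) : \sum_(t <- L) f t * in_class (\pi_(utree) c) t
    = \sum_(t <- [seq t <- L | iso t c]) f t.
  rewrite [RHS]big_filter [RHS]big_mkcond; apply: eq_bigr => t _; rewrite /in_class pi_iso.
  by case: (iso t c); rewrite (mulr1, mulr0).
have permD : perm_eq [seq t <- shapes n.+1 | iso t c] [seq t <- D | iso t c].
  apply: uniq_perm; [exact/filter_uniq/shapes_uniq|apply: filter_uniq|].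
    rewrite /D cat_uniq !map_inj_uniq ?shapes_uniq //=; [|by move=> ? ? []|by move=> ? ? []].
    rewrite andbT; apply/hasPn => _ /mapP[t ht ->]; apply/mapP => -[t' ht' []] t'L _.
    by move: ht' n1; rewrite -t'L mem_shapes => /eqP <-.
  move=> t; rewrite [LHS]mem_filter [RHS]mem_filter mem_shapes; case: (boolP (iso t c)) => //= tc.
  rewrite (iso_nleaves tc) nleaves_Node1 ns eqxx; apply/esym.
  rewrite mem_cat; case: t tc => [//|l r]; rewrite iso_Node1 ?ns // => /orP[] /andP[/eqP-> /iso_nleaves h].
    by rewrite map_f // mem_shapes h ns.
  by rewrite orbC map_f // mem_shapes h ns.
rewrite condE (perm_big _ permD) -condE big_cat !big_map /= -big_split mulr_sumr.
apply: eq_big_seq => t ht; have [-> ->] := incD t ht.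
have /eqP nt : nleaves t == n by rewrite -mem_shapes.
by rewrite /= nt (_ : nleaves (Leaf tt) = 1%N) // (symmC _ 1%N); ring.
Qed.

(** Since the subtrees of s have at least two leaves, no growth step other than
    that at the root edge makes a leaf adjacent to the first branch point. *)
Lemma joint_graft k (s : tree unit) l r : s = Node l r ->
  (1 < nleaves l)%N -> (1 < nleaves r)%N -> nleaves s = k.+2 ->
  P [set w | S k.+2 w = \pi_(utree) s
           /\ S k.+3 w = \pi_(utree) (Node s (Leaf tt))]%classic
  = (alpha / (k.+1%:R + theta) * \sum_(t <- shapes k.+2) f t * in_class (\pi_(utree) s) t)%:E.
Proof.
move=> sE nl nr ns; rewrite shape_joint_law; congr EFin.
rewrite -sum_branching_sym; last by move=> *; apply: in_class_iso.
rewrite -sum_tree_law_shape // mulr_sumr; apply: eq_big_seq => p hp.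
rewrite (sum_growths_shape _ _ hp) // [RHS]mulrCA; congr (p.1 * _).
rewrite {1}/in_class [in RHS]/in_class !pi_iso; case: (boolP (iso (unlabel p.2) s)) => [us|_]; last by rewrite mul0r mulr0.
rewrite mul1r mulr1.
case: (unlabel p.2) us => [[]|l' r'] us; first by rewrite sE in us.
have nu := iso_nleaves us; have s1 : (1 < nleaves s)%N by rewrite ns.
have [nl' nr'] : (1 < nleaves l')%N /\ (1 < nleaves r')%N.
  by move: us; rewrite sE /= => /orP[] /andP[/iso_nleaves-> /iso_nleaves->].
rewrite [shape_growths _ _ _]/= big_cons big_cat !big_map big1_seq ?big1_seq => [|q|q].
- rewrite [_.1]/= [_.2]/= [X in _ + X]/= /in_class pi_iso iso_Node1 // us eqxx mulr1 !addr0.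
  by rewrite /root_pr nu ns /= -[k.+2%:R]natr1 addrK.
- move=> /shape_growths_nleaves nq; rewrite /in_class pi_iso iso_Node1 //= !eqLeaf nq.
  by rewrite (gtn_eqF nl') !eqSS -[_ == 0%N]negbK -lt0n ltnW //= mulr0.
- move=> /shape_growths_nleaves nq; rewrite /in_class pi_iso iso_Node1 //= !eqLeaf nq.
  by rewrite (gtn_eqF nr') !eqSS -[_ == 0%N]negbK -lt0n ltnW //= mulr0.
Qed.

(** Removing any other leaf than the attached one keeps that leaf adjacent to the
    first branch point, which s has no leaf adjacent to. *)
Lemma pruned_joint_graft k (s : tree unit) l r : s = Node l r ->
  (1 < nleaves l)%N -> (1 < nleaves r)%N -> nleaves s = k.+2 ->
  pruned_joint_law P S k.+2 (\pi_(utree) s) (\pi_(utree) (Node s (Leaf tt)))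
  = (2 * symm (split_pr alpha theta) k.+2 1%N / k.+3%:R
     * \sum_(t <- shapes k.+2) f t * in_class (\pi_(utree) s) t)%:E.
Proof.
move=> sE nl nr ns; rewrite /pruned_joint_law shape_law -EFinM; congr EFin.
rewrite (sum_class_graft ns) // pruning_prob_sum nleaves_Node1 ns.
rewrite (_ : \sum_(v <- prunings _) _ = 1); first by ring.
have prE : prunings (Node s (Leaf tt)) = [seq Node v (Leaf tt) | v <- prunings s] ++ [:: s].
  by rewrite sE.
rewrite prE big_cat big_map big_seq1 big1_seq; first by rewrite /= add0r /in_class eqxx.
move=> v _; rewrite /in_class pi_iso {}sE {prE}.
by case: l nl => [//|l1 l2] _; case: r nr => [//|r1 r2] _; rewrite /= !andbF.
Qed.

Lemma strongly_consistent_graft k (s : tree unit) l r : s = Node l r ->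
  (1 < nleaves l)%N -> (1 < nleaves r)%N -> nleaves s = k.+2 ->
  strongly_sampling_consistent P S ->
  alpha / (k.+1%:R + theta) = 2 * symm (split_pr alpha theta) k.+2 1%N / k.+3%:R.
Proof.
move=> sE nl nr ns /(_ k.+2 isT (\pi_(utree) s) (\pi_(utree) (Node s (Leaf tt)))).
rewrite (joint_graft sE) // (pruned_joint_graft sE) // => -[].
apply: mulIf; apply: lt0r_neq0.
rewrite (bigD1_seq s) ?shapes_uniq ?mem_shapes ?ns //= {1}/in_class eqxx mulr1.
rewrite ltr_pwDl ?branching_gt0 // sumr_ge0 // => t _.
by rewrite mulr_ge0 ?in_class_ge0 // ltW ?branching_gt0.
Qed.

(** The equations for four and five leaves have the right-hand sides
    K := (1 - alpha) (2 - alpha) (3 - alpha) and K (4 - alpha), and left-hand sides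
    whose ratio is 3 + theta. *)
Lemma strongly_consistent_only_if :
  strongly_sampling_consistent P S ->
  alpha = 1 / 2 /\ theta = 1 / 2.
Proof.
have /andP[a0 a1] := alpha01.
move=> strong.
have := @strongly_consistent_graft 2 balanced4 cherry cherry erefl isT isT erefl strong.
have := @strongly_consistent_graft 3 (Node (Node cherry (Leaf tt)) cherry) _ _ erefl isT isT erefl strong.
rewrite /symm /split_pr /= /subn /= => E5 E4.
have t1 : 1 + theta != 0 by apply: lt0r_neq0; rewrite ltr_wpDr.
have t2 : 2 + theta != 0 by apply: lt0r_neq0; rewrite ltr_wpDr.
have t3 : 3 + theta != 0 by apply: lt0r_neq0; rewrite ltr_wpDr.
have t4 : 4 + theta != 0 by apply: lt0r_neq0; rewrite ltr_wpDr.
pose K := (1 - alpha) * (2 - alpha) * (3 - alpha).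
have K0 : K != 0 by rewrite !mulf_neq0 // lt0r_neq0 //; lra.
have {}E4 : (2 * alpha - theta) * (1 + theta) * (2 + theta) = K.
  apply/eqP; rewrite -subr_eq0; move/eqP: E4; rewrite -subr_eq0 => /eqP E4.
  apply/eqP; rewrite -[RHS](mulr0 (5 * (1 + theta) * (2 + theta) * (3 + theta))) -E4.
  by rewrite /K; field; rewrite t1 t2 t3.
have {}E5 : (2 * alpha - theta) * (1 + theta) * (2 + theta) * (3 + theta) = K * (4 - alpha).
  apply/eqP; rewrite -subr_eq0; move/eqP: E5; rewrite -subr_eq0 => /eqP E5.
  apply/eqP; rewrite -[RHS](mulr0 (6 * (1 + theta) * (2 + theta) * (3 + theta) * (4 + theta))) -E5.
  by rewrite /K; field; rewrite t1 t2 t3 t4.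
have th : theta = 1 - alpha.
  move: E5; rewrite E4 => /(mulfI K0); lra.
have := E4; rewrite /K th.
have -> : (2 * alpha - (1 - alpha)) * (1 + (1 - alpha)) * (2 + (1 - alpha))
  = ((2 - alpha) * (3 - alpha)) * (3 * alpha - 1) by ring.
have -> : (1 - alpha) * (2 - alpha) * (3 - alpha) = ((2 - alpha) * (3 - alpha)) * (1 - alpha) by ring.
have K1 : (2 - alpha) * (3 - alpha) != 0 by rewrite !mulf_neq0 // lt0r_neq0 //; lra.
by move/(mulfI K1) => h; split; lra.
Qed.

End Shapes.

(** * Exchangeability and the theorem *)

Section Exchangeable.
Local Open Scope quotient_scope.
Context (R : realType) (d : measure_display) (Omega : measurableType d).
Context (P : probability Omega R) (alpha theta : R) (T : nat -> {RV P >-> ltree}).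
Hypotheses (theta_ge0 : 0 <= theta) (proc : growth_process alpha theta T).

Lemma relabel_law k (s : nat -> nat) (t : tree nat) :
  P [set w | relabel s (T k.+1 w) = \pi_(ltree) t]%classic
  = (\sum_(p <- tree_law alpha theta k) p.1 * (iso (tmap s p.2) t)%:R)%:E.
Proof.
rewrite (_ : [set w | _]%classic = [set w | relabel s (T k.+1 w) == \pi_(ltree) t]%classic); last first.
  by apply/seteqP; split => w /= /eqP.
rewrite (law_event theta_ge0 proc k (fun v => relabel s v == \pi_(ltree) t)); congr EFin.
by apply: eq_bigr => p _; rewrite relabel_pi pi_iso.
Qed.

Lemma tree_point_law k (t : tree nat) :
  P [set w | T k.+1 w = \pi_(ltree) t]%classic
  = (\sum_(p <- tree_law alpha theta k) p.1 * (iso p.2 t)%:R)%:E.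
Proof.
rewrite (_ : [set w | _]%classic = [set w | T k.+1 w == \pi_(ltree) t]%classic); last first.
  by apply/seteqP; split => w /= /eqP.
rewrite (law_event theta_ge0 proc k (fun v => v == \pi_(ltree) t)); congr EFin.
by apply: eq_bigr => p _; rewrite pi_iso.
Qed.

Lemma exchangeable_if : alpha = 1 / 2 -> theta = 1 / 2 ->
  forall n, (1 <= n)%N -> exchangeable_labels n (T n).
Proof.
move=> al th [//|k] _ s ps t; rewrite -[t]reprK relabel_law tree_point_law al th.
congr EFin; apply: (sum_tree_law_relabel (F := fun v => (iso v (repr t))%:R)) => //.
by move=> v v' vv; rewrite -!pi_iso; move: vv; rewrite -pi_iso => /eqP->.
Qed.

(** Two transpositions of the labels 1, 2, 3 compare the probabilities of the
    three trees. *)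
Lemma exchangeable_only_if :
  (forall n, (1 <= n)%N -> exchangeable_labels n (T n)) -> alpha = 1 / 2 /\ theta = 1 / 2.
Proof.
move=> /(_ 3%N isT) ex.
pose swap a b i : nat := if i == a then b else if i == b then a else i.
have := ex (swap 2 3)%N isT (\pi_(ltree) (Node (Node (Leaf 1%N) (Leaf 2%N)) (Leaf 3%N))).
have := ex (swap 1 2)%N isT (\pi_(ltree) (Node (Leaf 1%N) (Node (Leaf 2%N) (Leaf 3%N)))).
rewrite !relabel_law !tree_point_law /= !big_cons !big_nil /swap /nleaves /= => -[E1] -[E2].
have t1 : 1 + theta != 0 by apply: lt0r_neq0; rewrite ltr_wpDr.
have t2 : alpha + theta + (1 - alpha) != 0.
  by rewrite (_ : _ + _ = 1 + theta) //; ring.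
have e1 : theta - (1 - alpha) = 0.
  move/eqP: E1; rewrite -subr_eq0 => /eqP E1.
  by rewrite -[RHS](mulr0 (1 + theta)) -E1; field.
have e2 : theta - alpha = 0.
  move/eqP: E2; rewrite -subr_eq0 => /eqP E2.
  by rewrite -[RHS](mulr0 (1 + theta)) -E2; field.
by split; lra.
Qed.

End Exchangeable.

Theorem proposition1 (R : realType) (d : measure_display)
    (Omega : measurableType d) (P : probability Omega R) (alpha theta : R)
    (T : nat -> {RV P >-> ltree}) :
  0 < alpha < 1 -> 0 <= theta -> growth_process alpha theta T ->
  [/\ (forall n : nat, (1 <= n)%N -> exchangeable_labels n (T n))
        <-> (alpha = 1 / 2 /\ theta = 1 / 2),
      strongly_sampling_consistent P (fun n w => delabel (T n w))
        <-> (alpha = 1 / 2 /\ theta = 1 / 2)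
    & weakly_sampling_consistent P (fun n w => delabel (T n w))
        <-> (theta = 1 - alpha \/ theta = 2 - alpha)].
Proof.
move=> alpha01 theta_ge0 proc; split; split.
- exact: (exchangeable_only_if theta_ge0 proc).
- by case=> al th; apply: (exchangeable_if theta_ge0 proc al th).
- exact: (strongly_consistent_only_if alpha01 theta_ge0 proc).
- by case=> al th; apply: (strongly_consistent_if theta_ge0 proc al th).
- exact: (weakly_consistent_only_if alpha01 theta_ge0 proc).
- exact: (weakly_consistent_if alpha01 theta_ge0 proc).
Qed.
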